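(* A model $(\mathcal M,\theta)\models T_\theta$ is an existentially closed model of $T_\theta$ if and only if $$(\mathcal M,\theta)\models\exists\underline x\in\mathbb V:\psi_\theta(\underline x)\wedge\bigwedge_{k=1}^n\xi_k[\theta](x_{m+k})=\sum_{l=1}^mP_{k,l}[\theta](x_l)+v_k,$$ where $\underline x=(x_1,\dots,x_{m+n})$, holds for all: (i) tuples of polynomials $(\xi_1,\dots,\xi_n)$ and $(P_{k,l}:1\le k\le n,1\le l\le m)$ in $K[X]$ with $\deg(\xi_k)>0$ for all $k$; (ii) $L(M)$-formulas $\psi(\vec x)$ that do not imply any finite disjunction of non-trivial linear dependencies in $\vec x$ over $\mathbb V$ and in which $x^i_{m+k}$ does not occur for $i\ge\deg(\xi_k)$; (iii) $v_1,\dots,v_n\in\mathbb V$.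
   Context: Setting: $L$ is a first-order language, $T$ a model-complete $L$-theory and $K$ a field. There are $L$-formulas without parameters which define, in every model $\mathcal M\models T$, a nontrivial $K$-vector space $\mathbb V=\mathbb V^{\mathcal M}$; elements of $\mathbb V$ are treated as single elements. $L_\theta=L\cup\{\theta\}$, $\theta$ a new unary function symbol; $T_\theta$ is $T$ plus axioms saying $\theta|_{\mathbb V}$ is a $K$-linear endomorphism of $\mathbb V$ and $\theta(x)=0$ for $x\notin\mathbb V$. For $\rho=\sum_i(\rho)_iX^i\in K[X]$, $\rho[\theta]:=\sum_i(\rho)_i\theta^i$. Existentially closed model of $T'$: for every extension $(\mathcal M',\theta')\supseteq(\mathcal M,\theta)$ with $(\mathcal M',\theta')\models T'$, every existential sentence with parameters in $\mathcal M$ true in the extension is true in $(\mathcal M,\theta)$. Placeholder notation: for $\underline x=(x_1,\dots,x_N)$, $\vec x=(x_k^i:1\le k\le N,i\in\omega)$ are new variables; $\psi_\theta(\underline x)$ is $\psi(\vec x)$ with each $x^i_k$ replaced by $\theta^i(x_k)$. $\psi(\vec x)$ implies no finite disjunction of non-trivial linear dependencies in $\vec x$ over $\mathbb V$ if there are no finitely many equations $\sum_{k,i}a^{(j)}_{k,i}x^i_k=v_j$ ($a^{(j)}_{k,i}\in K$ not all zero, $v_j\in\mathbb V$) whose disjunction is implied by $\psi(\vec x)\wedge\vec x\in\mathbb V$ in $\mathcal M$. *)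

(* Defs.v *)
From mathcomp Require Import all_boot all_algebra.
From Stdlib Require Import ClassicalEpsilon.
Set Implicit Arguments. Unset Strict Implicit. Unset Printing Implicit Defensive.
Import GRing.Theory.
Local Open Scope ring_scope.

Record Lang := {
  Fsym : Type; Rsym : Type;
  farity : Fsym -> nat; rarity : Rsym -> nat }.

Inductive term (L : Lang) : Type :=
| tvar : nat -> term L
| tapp : forall f : Fsym L, ('I_(farity f) -> term L) -> term L.

Inductive formula (L : Lang) : Type :=
| fFalse : formula L
| fEq : term L -> term L -> formula L
| fRel : forall r : Rsym L, ('I_(rarity r) -> term L) -> formula L
| fNot : formula L -> formula L
| fAnd : formula L -> formula L -> formula L
| fOr : formula L -> formula L -> formula L
| fImp : formula L -> formula L -> formula L
| fAll : nat -> formula L -> formula L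
| fEx : nat -> formula L -> formula L.

Record Struc (L : Lang) := {
  dom :> Type;
  dom_inh : inhabited dom;
  finterp : forall f : Fsym L, ('I_(farity f) -> dom) -> dom;
  rinterp : forall r : Rsym L, ('I_(rarity r) -> dom) -> Prop }.

Section Semantics.
Variable L : Lang.

Fixpoint eval (M : Struc L) (a : nat -> M) (t : term L) : M :=
  match t with
  | tvar n => a n
  | tapp f ts => @finterp L M f (fun i => eval a (ts i))
  end.

Definition upd (M : Type) (a : nat -> M) (x : nat) (v : M) : nat -> M :=
  fun n => if n == x then v else a n.

Fixpoint holds (M : Struc L) (a : nat -> M) (phi : formula L) : Prop :=
  match phi with
  | fFalse => False
  | fEq t1 t2 => eval a t1 = eval a t2
  | fRel r ts => @rinterp L M r (fun i => eval a (ts i))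
  | fNot p => ~ holds a p
  | fAnd p q => holds a p /\ holds a q
  | fOr p q => holds a p \/ holds a q
  | fImp p q => holds a p -> holds a q
  | fAll x p => forall v : M, holds (upd a x v) p
  | fEx x p => exists v : M, holds (upd a x v) p
  end.

Fixpoint tfree (x : nat) (t : term L) : Prop :=
  match t with
  | tvar n => n = x
  | tapp f ts => exists i, tfree x (ts i)
  end.

Fixpoint ofree (x : nat) (phi : formula L) : Prop :=
  match phi with
  | fFalse => False
  | fEq t1 t2 => tfree x t1 \/ tfree x t2
  | fRel r ts => exists i, tfree x (ts i)
  | fNot p => ofree x p
  | fAnd p q | fOr p q | fImp p q => ofree x p \/ ofree x q
  | fAll y p | fEx y p => y <> x /\ ofree x p
  end.

Definition sentence (phi : formula L) : Prop := forall x, ~ ofree x phi.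

Definition is_theory (T : formula L -> Prop) : Prop :=
  forall phi, T phi -> sentence phi.

Definition fo_model (T : formula L -> Prop) (M : Struc L) : Prop :=
  forall phi, T phi -> forall a : nat -> M, holds a phi.

Fixpoint qf (phi : formula L) : Prop :=
  match phi with
  | fFalse | fEq _ _ | fRel _ _ => True
  | fNot p => qf p
  | fAnd p q | fOr p q | fImp p q => qf p /\ qf q
  | fAll _ _ | fEx _ _ => False
  end.

Inductive existential : formula L -> Prop :=
| ex_qf phi : qf phi -> existential phi
| ex_ex x phi : existential phi -> existential (fEx x phi).

Record embedding (M N : Struc L) (e : M -> N) : Prop := {
  emb_inj : injective e;
  emb_fun : forall f args, e (@finterp L M f args) = @finterp L N f (fun i => e (args i));
  emb_rel : forall r args, @rinterp L M r args <-> @rinterp L N r (fun i => e (args i)) }.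

Definition model_complete (T : formula L -> Prop) : Prop :=
  forall (M N : Struc L) (e : M -> N), fo_model T M -> fo_model T N -> embedding e ->
    forall (phi : formula L) (a : nat -> M), holds a phi <-> holds (e \o a) phi.

End Semantics.

(* Conventions: fV has ofree variable 0 ("x in V");
   fAdd has ofree variables 0,1,2 ("v2 = v0 + v1");
   fSmul c has ofree variables 0,1 ("v1 = c . v0"). *)
Record VSdef (L : Lang) (K : fieldType) := {
  fV : formula L; fAdd : formula L; fSmul : K -> formula L }.

Section VectorSpace.
Variables (L : Lang) (K : fieldType) (D : VSdef L K).

Definition env3 (M : Type) (x y z : M) : nat -> M :=
  fun n => match n with 0 => x | 1 => y | _ => z end.

Definition inV (M : Struc L) (x : M) : Prop := holds (env3 x x x) (fV D).

Definition vadd (M : Struc L) (x y : M) : M :=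
  epsilon (dom_inh M) (fun z => inV z /\ holds (env3 x y z) (fAdd D)).
Definition vsmul (M : Struc L) (c : K) (x : M) : M :=
  epsilon (dom_inh M) (fun y => inV y /\ holds (env3 x y y) (fSmul D c)).
Definition vzero (M : Struc L) : M :=
  epsilon (dom_inh M) (fun z => inV z /\ forall x : M, inV x -> vadd x z = x).

Definition defines_vs (T : formula L -> Prop) : Prop :=
  (forall n, ofree n (fV D) -> n = 0%N) /\
  (forall n, ofree n (fAdd D) -> (n <= 2)%N) /\
  (forall c n, ofree n (fSmul D c) -> (n <= 1)%N) /\
  forall M : Struc L, fo_model T M ->
  exists (add : M -> M -> M) (smul : K -> M -> M) (z : M),
    inV z /\
    (forall x y, inV x -> inV y -> inV (add x y)) /\
    (forall c x, inV x -> inV (smul c x)) /\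
    (forall x y w, holds (env3 x y w) (fAdd D) <-> [/\ inV x, inV y & w = add x y]) /\
    (forall c x y, holds (env3 x y y) (fSmul D c) <-> inV x /\ y = smul c x) /\
    (forall x y w, inV x -> inV y -> inV w -> add x (add y w) = add (add x y) w) /\
    (forall x y, inV x -> inV y -> add x y = add y x) /\
    (forall x, inV x -> add z x = x) /\
    (forall x, inV x -> add x (smul (-1) x) = z) /\
    (forall c x y, inV x -> inV y -> smul c (add x y) = add (smul c x) (smul c y)) /\
    (forall c d x, inV x -> smul (c + d) x = add (smul c x) (smul d x)) /\
    (forall c d x, inV x -> smul (c * d) x = smul c (smul d x)) /\
    (forall x, inV x -> smul 1 x = x) /\
    (exists x, inV x /\ x <> z).

Definition vsum (M : Struc L) (n : nat) (f : nat -> M) : M :=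
  foldr (@vadd M) (vzero M) [seq f i | i <- iota 0 n].

Definition polyact (M : Struc L) (th : M -> M) (rho : {poly K}) (x : M) : M :=
  vsum (size rho) (fun i => vsmul rho`_i (iter i th x)).

Definition Ttheta_model (T : formula L -> Prop) (M : Struc L) (th : M -> M) : Prop :=
  [/\ fo_model T M,
      (forall x, inV x -> inV (th x)),
      (forall x y, inV x -> inV y -> th (vadd x y) = vadd (th x) (th y)),
      (forall c x, inV x -> th (vsmul c x) = vsmul c (th x)) &
      (forall x, ~ inV x -> th x = vzero M)].

End VectorSpace.

Definition Ltheta (L : Lang) : Lang := {|
  Fsym := option (Fsym L); Rsym := Rsym L;
  farity := fun f => match f with Some g => farity g | None => 1%N end;
  rarity := @rarity L |}.

Definition expand (L : Lang) (M : Struc L) (th : M -> M) : Struc (Ltheta L) := {|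
  dom := M; dom_inh := dom_inh M;
  finterp := fun f => match f return ('I_(@farity (Ltheta L) f) -> M) -> M with
                      | Some g => @finterp L M g
                      | None => fun args => th (args ord0) end;
  rinterp := @rinterp L M |}.

(* (M, th) is an existentially closed fo_model of T_theta (given that it is a
   fo_model): every existential L_theta-sentence with parameters in M (an
   existential formula phi with its ofree variables assigned by a) true in an
   extension (N, thN) |= T_theta is true in (M, th). *)
Definition ec_model (L : Lang) (K : fieldType) (D : VSdef L K)
    (T : formula L -> Prop) (M : Struc L) (th : M -> M) : Prop :=
  forall (N : Struc L) (thN : N -> N) (e : M -> N),
    Ttheta_model D T thN -> embedding e -> (forall x, e (th x) = thN (e x)) ->
    forall (phi : formula (Ltheta L)) (a : nat -> M),
      existential phi -> holds (M := expand thN) (e \o a) phi ->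
      holds (M := expand th) a phi.

(* the placeholder x_k^i is the L-variable number 2^k * (2i+1) (k, i >= 0);
   this is a bijection from nat*nat onto the positive variables, with
   inverse given by pkidx, pidx below.  Variable 0 is never a placeholder. *)
Definition pv (k i : nat) : nat := (2 ^ k * (2 * i + 1))%N.
Definition pkidx (v : nat) : nat := logn 2 v.
Definition pidx (v : nat) : nat := ((v %/ 2 ^ logn 2 v).-1)./2.

(* assignment for an L(M)-formula psi(vec x) with parameters p:
   the placeholder x_k^i (k < N) gets X k i, every other variable gets its
   parameter value p. *)
Definition ph (M : Type) (X : nat -> nat -> M) (N : nat) (p : nat -> M) : nat -> M :=
  fun v => if (0 < v)%N && (pkidx v < N)%N then X (pkidx v) (pidx v) else p v.

Section LinDep.
Variables (L : Lang) (K : fieldType) (D : VSdef L K) (M : Struc L).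

Definition no_lin_dep (N : nat) (phi : formula L) (p : nat -> M) : Prop :=
  ~ exists (J B : nat) (a : nat -> nat -> nat -> K) (v : nat -> M),
      (forall j, (j < J)%N ->
         inV D (v j) /\ exists k i, [/\ (k < N)%N, (i < B)%N & a j k i != 0]) /\
      forall X : nat -> nat -> M,
        (forall k i, (k < N)%N -> inV D (X k i)) ->
        holds (ph X N p) phi ->
        exists j, (j < J)%N /\
          vsum D N (fun k => vsum D B (fun i => vsmul D (a j k i) (X k i))) = v j.

End LinDep.

(* Main.v *)
Require Import Defs.
From HB Require Import structures.
From mathcomp Require Import all_boot all_algebra.
From mathcomp Require Import boolp classical_sets filter.
Set Implicit Arguments. Unset Strict Implicit. Unset Printing Implicit Defensive.
Import GRing.Theory.
Local Open Scope ring_scope.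

(** Both directions replace compactness by ultrapowers of M, and model
    completeness makes every embedding between models of T elementary.

    Existentially closed implies solvable: since psi implies no finite disjunction
    of linear dependencies, an ultrapower N of M contains a realization (x_k^i) of
    psi which is linearly independent over V(M). Extend theta to V(N) by shifting
    x_k^i to x_k^(i+1), except that for k > m the last vector of index deg(xi_k)-1
    is sent where the k-th equation requires it. As (M, theta) is existentially
    closed in (N, theta), the latter embeds over M into an ultrapower of (M, theta),
    and Los's theorem brings the solution back to M.

    Solvable implies existentially closed: let a quantifier-free formula hold at a
    tuple b in an extension (N, theta). The K[X]-submodule generated over V(M) by
    the elements of V(N) involved is, modulo V(M), a direct sum of cyclic modules;
    it is generated by h_1, ..., h_(m+n) with h_1, ..., h_m free and
    xi_k[theta](h_(m+k)) in V(M). For each finite part of the L-diagram of N over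
    M, the statement that it is realized around the theta^i(h_k) is a formula psi
    implying no finite disjunction of dependencies, so the hypothesis (with P = 0)
    solves it in M. The solutions assemble into an L-embedding of N into an ultrapower
    of M that commutes with theta on the submodule and outside V(N). *)

(** * Polynomial combinations and modules over K[X] *)

Section PolyLin.
Variables (K : fieldType) (V : lmodType K).
Implicit Types (x : nat -> V) (p q : {poly K}).

(** This is the [K]-linear map sending ['X^i] to [x i]; a finitely supported family of coefficients
    is thus carried by one polynomial. *)
Definition pl x p : V := \sum_(i < size p) p`_i *: x i.

Lemma pl_bound x p n : (size p <= n)%N -> pl x p = \sum_(i < n) p`_i *: x i.
Proof.
move=> le_pn; rewrite /pl (big_ord_widen n (fun i => p`_i *: x i)) // big_mkcond /=.
apply: eq_bigr => i _; case: ltnP => // le_pi.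
by rewrite nth_default // scale0r.
Qed.

Lemma pl_is_linear x : linear (pl x).
Proof.
move=> a p q; pose n := maxn (size p) (size q).
have le_p : (size p <= n)%N by rewrite leq_maxl.
have le_q : (size q <= n)%N by rewrite leq_maxr.
have le_pq : (size (a *: p + q)%R <= n)%N.
  by rewrite (leq_trans (size_polyD _ _)) // geq_max le_q (leq_trans (size_scale_leq _ _)).
rewrite !(@pl_bound x _ n) // scaler_sumr -big_split /=.
by apply: eq_bigr => i _; rewrite coefD coefZ scalerDl scalerA.
Qed.

HB.instance Definition _ x := GRing.isLinear.Build K {poly K} V *:%R (pl x) (pl_is_linear x).

Lemma pl_ext x y p : (forall i, (i < size p)%N -> x i = y i) -> pl x p = pl y p.
Proof. by move=> xy; apply: eq_bigr => i _; rewrite xy. Qed.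

Lemma pl_Xn x i : pl x 'X^i = x i.
Proof.
rewrite (@pl_bound _ _ i.+1) ?size_polyXn // big_ord_recr /= coefXn eqxx scale1r.
rewrite big1 ?add0r // => j _; rewrite coefXn ltn_eqF ?scale0r //.
Qed.

Lemma pl_mulX x p : pl x (p * 'X) = pl (x \o S) p.
Proof.
rewrite (@pl_bound _ _ (size p).+1) ?(leq_trans (size_polyMleq _ _)) ?size_polyX ?addn2 //.
rewrite big_ord_recl coefMX eqxx scale0r add0r.
by apply: eq_bigr => i _; rewrite coefMX /=.
Qed.

End PolyLin.

Lemma pl_map (K : fieldType) (V W : lmodType K) (f : {linear V -> W}) x p :
  f (pl x p) = pl (f \o x) p.
Proof. by rewrite linear_sum; apply: eq_bigr => i _; rewrite linearZ. Qed.

Section PolyAct.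
Variables (K : fieldType) (V : lmodType K) (f : {linear V -> V}).
Implicit Types (p q : {poly K}) (v : V).

(** This is [p[f]] applied to [v]. *)
Definition pact p v : V := pl (fun i => iter i f v) p.

Fact iter_is_linear i : linear (iter i f).
Proof. by move=> a u v; elim: i => //= i ->; rewrite linearP. Qed.

Lemma pact_is_linear p : linear (pact p).
Proof.
move=> a u v; rewrite /pact /pl scaler_sumr -big_split /=; apply: eq_bigr => i _.
by rewrite iter_is_linear scalerDr !scalerA mulrC.
Qed.

HB.instance Definition _ p := GRing.isLinear.Build K V V *:%R (pact p) (pact_is_linear p).

Lemma pactD p q v : pact (p + q) v = pact p v + pact q v.
Proof. by rewrite /pact linearD. Qed.

Lemma pactC c v : pact c%:P v = c *: v.
Proof. by rewrite -[c%:P]mulr1 mul_polyC /pact linearZ /= -(expr0 'X) pl_Xn. Qed.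

Lemma pact1 v : pact 1 v = v.
Proof. by rewrite -[1]/(1%:P) pactC scale1r. Qed.

Lemma pact_mulX p v : pact (p * 'X) v = pact p (f v).
Proof.
by rewrite /pact pl_mulX; apply: pl_ext => i _ /=; rewrite -iterSr.
Qed.

Lemma pact_comm p v : pact p (f v) = f (pact p v).
Proof.
by rewrite /pact pl_map; apply: pl_ext => i _ /=; rewrite -iterSr.
Qed.

Lemma pactXn i v : pact 'X^i v = iter i f v.
Proof. by rewrite /pact pl_Xn. Qed.

(** Horner induction on [p]: a factor ['X] acts as [f], and [f] commutes with every [pact f q]. *)
Lemma pactM p q v : pact (p * q) v = pact p (pact q v).
Proof.
elim/poly_ind: p q => [|p c IHp] q.
  by rewrite mul0r /pact !linear0.
rewrite mulrDl !pactD -mulrA IHp mul_polyC pactC; congr (_ + _); last by rewrite /pact linearZ.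
by rewrite -['X * q]commr_polyX !pact_mulX pact_comm.
Qed.

(** A copy of [V] that records the endomorphism in its type, so that the [{poly K}]-module structure
    does not clash with the [K]-structure of [V]. *)
Definition pmod (g : {linear V -> V}) : Type := V.

End PolyAct.

HB.instance Definition _ (K : fieldType) (V : lmodType K) (f : {linear V -> V}) :=
  GRing.Zmodule.copy (pmod f) V.

Section PolyModule.
Variables (K : fieldType) (V : lmodType K) (f : {linear V -> V}).

Fact pmod_scalerA (p q : {poly K}) (v : pmod f) : pact f p (pact f q v) = pact f (p * q) v.
Proof. by rewrite pactM. Qed.
Fact pmod_scale1r : left_id 1 (pact f : {poly K} -> pmod f -> pmod f).
Proof. exact: pact1. Qed.
Fact pmod_scalerDr : right_distributive (pact f : {poly K} -> pmod f -> pmod f) +%R.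
Proof. by move=> p u v; rewrite linearD. Qed.
Fact pmod_scalerDl (v : pmod f) :
  {morph (fun p => pact f p v : pmod f) : p q / p + q}.
Proof. by move=> p q; rewrite pactD. Qed.

HB.instance Definition _ := GRing.Zmodule_isLmodule.Build {poly K} (pmod f)
  pmod_scalerA pmod_scale1r pmod_scalerDr pmod_scalerDl.

Lemma pmod_scaleE (p : {poly K}) (v : pmod f) : p *: v = pact f p v.
Proof. by []. Qed.

End PolyModule.

(** * Extending partial linear maps *)

Section LinearExtension.
Variables (K : fieldType) (V W : lmodType K).
Local Open Scope classical_set_scope.

Definition lin_closed (G : set (V * W)) := forall a z z', G z -> G z' -> G (a *: z + z').
(** For a set closed under linear combinations this already makes it the graph of a function, by
    subtraction. *)
Definition functional0 (G : set (V * W)) := forall y, G (0, y) -> y = 0.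

(** Zorn's lemma gives a maximal linear graph containing [G]; its domain is everything, since a
    missing [x] could still be sent to 0. *)
Lemma linear_extension (G : set (V * W)) :
  G (0, 0) -> lin_closed G -> functional0 G ->
  exists f : {linear V -> W}, forall x y, G (x, y) -> f x = y.
Proof.
move=> G00 Gcl Gfun.
(* Only a nonempty [A] has to contain [G], so that the empty union also satisfies [P]. *)
pose P A := [/\ lin_closed A, functional0 A & forall z, A z -> G `<=` A].
have [A [[Acl Afun AG] Amax]] : exists A, P A /\ forall B, A `<` B -> ~ P B.
  apply: Zorn_bigcup => F FP Ftot; split.
  - move=> a z z' [A FA Az] [B FB Bz'].
    have [sAB|sBA] := Ftot _ _ FA FB.
      by exists B => //; have [cl _ _] := FP _ FB; apply: cl => //; apply: sAB.
    by exists A => //; have [cl _ _] := FP _ FA; apply: cl => //; apply: sBA.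
  - by move=> y [A FA]; have [_ + _] := FP _ FA; apply.
  - move=> z [A FA Az] w Gw; exists A => //.
    by have [_ _ sub] := FP _ FA; exact: (sub z Az).
have GA : G `<=` A.
  have [[z /AG//]|nA] := pselect (exists z, A z).
  exfalso; apply: (Amax G); last by split=> // z _ w.
  split; first by move=> z Az; case: nA; exists z.
  by move=> /(_ _ G00) A0; apply: nA; exists (0, 0).
have A00 := GA _ G00.
have Atot x : exists y, A (x, y).
  apply: contrapT => nx.
  pose B : set (V * W) := [set z | exists u w c, A (u, w) /\ z = (u + c *: x, w)].
  apply: (Amax B).
    split; first by move=> [u w] Auw; exists u, w, 0; rewrite scale0r addr0.
    move=> BA; apply: nx; exists 0; apply: BA.
    by exists 0, 0, 1; rewrite scale1r add0r.
  split.
  - move=> a _ _ [u [w [c [Auw ->]]]] [u' [w' [c' [Auw' ->]]]].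
    exists (a *: u + u'), (a *: w + w'), (a * c + c'); split.
      exact: (Acl _ _ _ Auw Auw').
    by congr (_, _) => /=; rewrite scalerDr scalerDl scalerA addrACA.
  - move=> y [u [w [c [Auw [u0 ->]]]]].
    (* A nonzero [c] would express [x] through [u] and so put it into the domain of [A]. *)
    have [c0|c_neq0] := eqVneq c 0.
      by apply: Afun; rewrite u0 c0 scale0r addr0.
    case: nx; exists (- c^-1 *: w).
    have -> : x = - c^-1 *: u.
      have -> : u = - (c *: x) by apply/eqP; rewrite -addr_eq0 -u0.
      by rewrite scalerN scaleNr opprK scalerA mulVf // scale1r.
    by have := Acl (- c^-1) _ _ Auw A00; rewrite addr0.
  - move=> _ _ z Gz; exists z.1, z.2, 0; rewrite scale0r addr0; split; last by case: z Gz.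
    by rewrite -surjective_pairing; apply: GA.
have [f fP] := choice Atot.
have Afn x y y' : A (x, y) -> A (x, y') -> y = y'.
  move=> Ay Ay'; apply/eqP; rewrite -subr_eq0; apply/eqP; apply: Afun.
  have := Acl (-1) _ _ Ay' Ay.
  by rewrite scaleN1r -[_ + _]/(- x + x, - y' + y) addNr addrC.
have f_lin : linear f.
  by move=> a u v; apply: (Afn (a *: u + v)); [|apply: (Acl a (u, _) (v, _))].
pose F : {linear V -> W} := HB.pack f (GRing.isLinear.Build K V W *:%R f f_lin).
by exists F => x y Gxy; apply: (Afn x) => //; apply: GA.
Qed.

End LinearExtension.

(** * Avoiding finitely many linear equations *)

Section Avoid.
Variables (K : fieldType) (V : lmodType K) (I : eqType).
Hypothesis V_infinite : forall s : seq V, exists x, x \notin s.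

(* Greedy choice: once the earlier unknowns are fixed, each equation excludes at most one value of the next one. *)
Lemma avoid_equations (r : seq I) (E : seq ((I -> K) * V)) : uniq r ->
  exists y : I -> V, forall e, e \in E -> (exists2 i, i \in r & e.1 i != 0) ->
    \sum_(i <- r) e.1 i *: y i <> e.2.
Proof.
elim: r => [|j r IHr] /=; first by exists (fun=> 0) => e _ [i].
move=> /andP[j_r /IHr[y yP]].
(* The list holds, for each equation with nonzero coefficient at [j], the only value of the new
   unknown that solves it; where the coefficient is 0 the entry is a harmless default. *)
have [x xP] := V_infinite [seq (e.1 j)^-1 *: (e.2 - \sum_(i <- r) e.1 i *: y i) | e <- E].
exists (fun i => if i == j then x else y i) => e Ee [i r_i ei].
rewrite big_cons eqxx.
have -> : \sum_(i <- r) e.1 i *: (if i == j then x else y i) = \sum_(i <- r) e.1 i *: y i.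
  rewrite big_seq [RHS]big_seq; apply: eq_bigr => k rk; case: eqP => // kj.
  by rewrite -kj rk in j_r.
have [ej0|ej_neq0] := eqVneq (e.1 j) 0.
  rewrite ej0 scale0r add0r; apply: yP => //; exists i => //.
  by move: r_i; rewrite inE => /predU1P[ij|//]; rewrite ij ej0 eqxx in ei.
move=> eqe; move/negP: xP; apply; apply/mapP; exists e => //.
by rewrite -eqe addrK scalerA mulVf // scale1r.
Qed.

End Avoid.

(** * Finitely generated modules over K[X], relative to a submodule *)

Section CyclicDecomposition.
Variables (K : fieldType) (A : lmodType {poly K}) (B : A -> Prop).
Hypotheses (B0 : B 0) (Bcl : forall a x y, B x -> B y -> B (a *: x + y)).

Let BZ a x : B x -> B (a *: x).
Proof. by move=> Bx; rewrite -[_ *: _]addr0; apply: Bcl. Qed.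
Let BB x y : B x -> B y -> B (x - y).
Proof. by move=> Bx By; rewrite addrC -scaleN1r; apply: Bcl. Qed.

(** Spans are taken modulo [B], which later becomes the image of V(M). *)
Definition inspan r (g : 'I_r -> A) x := exists c : 'I_r -> {poly K}, B (x - \sum_i c i *: g i).

Lemma inspan_B r (g : 'I_r -> A) x : B x -> inspan g x.
Proof. by exists (fun=> 0); rewrite big1 ?subr0 // => i _; rewrite scale0r. Qed.

Lemma inspan_lin r (g : 'I_r -> A) a x y :
  inspan g x -> inspan g y -> inspan g (a *: x + y).
Proof.
move=> [c Bc] [d Bd]; exists (fun i => a * c i + d i).
have -> : \sum_i (a * c i + d i) *: g i = a *: (\sum_i c i *: g i) + \sum_i d i *: g i.
  rewrite scaler_sumr -big_split /=; apply: eq_bigr => i _.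
  by rewrite scalerDl scalerA.
by rewrite opprD addrACA -scalerBr; apply: Bcl.
Qed.

Lemma inspan_gen r (g : 'I_r -> A) i : inspan g (g i).
Proof.
exists (fun j => (j == i)%:R); rewrite (bigD1 i) //= eqxx scale1r big1 ?addr0 ?subrr //.
by move=> j /negPf->; rewrite scale0r.
Qed.

Lemma inspan_sum r (g : 'I_r -> A) s (c : 'I_s -> {poly K}) (t : 'I_s -> A) (P : pred 'I_s) :
  (forall i, P i -> inspan g (t i)) -> inspan g (\sum_(i | P i) c i *: t i).
Proof.
move=> gt; apply: (big_rec (inspan g)) => [|i x Pi gx]; first exact: inspan_B.
by apply: inspan_lin => //; apply: gt.
Qed.

Lemma inspan_trans r (g : 'I_r -> A) s (t : 'I_s -> A) x :
  (forall i, inspan g (t i)) -> inspan t x -> inspan g x.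
Proof.
move=> gt [c Bc]; rewrite -(subrK (\sum_i c i *: t i) x) -[x - _]scale1r.
by apply: inspan_lin; [apply: inspan_B | apply: inspan_sum].
Qed.

(** An elementary change of generators: it keeps the span and changes the coefficients of a relation
    as in one step of Euclid's algorithm. *)
Definition shear r (t : 'I_r -> A) j (q : 'I_r -> {poly K}) k :=
  if k == j then t j + \sum_(i | i != j) q i *: t i else t k.

Lemma shear_sum r (t : 'I_r -> A) j q (c : 'I_r -> {poly K}) :
  \sum_i c i *: t i =
  \sum_i (if i == j then c j else c i - c j * q i) *: shear t j q i.
Proof.
rewrite (bigD1 j) //= [RHS](bigD1 j) //= /shear eqxx scalerDr -addrA; congr (_ + _).
rewrite scaler_sumr -big_split /=; apply: eq_bigr => i /negPf->.
by rewrite scalerBl scalerA addrC subrK.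
Qed.

Lemma shear_sub r (t : 'I_r -> A) j q k : inspan t (shear t j q k).
Proof.
rewrite /shear; case: eqP => _; last exact: inspan_gen.
rewrite -[t j]scale1r; apply: inspan_lin; first exact: inspan_gen.
by apply: inspan_sum => i _; apply: inspan_gen.
Qed.

Lemma sub_shear r (t : 'I_r -> A) j q k : inspan (shear t j q) (t k).
Proof.
have [->|kj] := eqVneq k j; last first.
  by have := inspan_gen (shear t j q) k; rewrite {2}/shear (negPf kj).
have -> : t j = (-1) *: (\sum_(i | i != j) q i *: shear t j q i) + shear t j q j.
  rewrite {2}/shear eqxx scaleN1r addrCA -[LHS]addr0; congr (_ + _).
  apply/esym/eqP; rewrite addrC subr_eq0; apply/eqP/eq_bigr => i.
  by rewrite /shear => /negPf->.
apply: inspan_lin; last exact: inspan_gen.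
by apply: inspan_sum => i _; apply: inspan_gen.
Qed.

(* Among all relations between generators, over all generating tuples of the
   given length, take one with a coefficient of minimal degree: by minimality
   it divides the other coefficients of the relation, which a shear removes. *)
Lemma split_cyclic_summand r (g : 'I_r.+1 -> A) c j :
  B (\sum_i c i *: g i) -> c j != 0 ->
  exists (t : 'I_r.+1 -> A) (k : 'I_r.+1) (d : {poly K}),
    [/\ d != 0, B (d *: t k),
        forall e, B (\sum_i e i *: t i) -> d %| e k,
        forall i, inspan t (g i) & forall i, inspan g (t i)].
Proof.
move=> Bc cj.
pose Q s := exists (t : 'I_r.+1 -> A) c j, [/\ forall i, inspan t (g i), forall i, inspan g (t i),
  B (\sum_i c i *: t i), c j != 0 & size (c j : {poly K}) = s].
have exQ : exists s, `[< Q s >].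
  exists (size (c j)); apply/asboolP; exists g, c, j; split => // i; exact: inspan_gen.
have [s /asboolP[t [{}c [{}j [gt tg {}Bc {}cj szc]]]] smin] := ex_minnP exQ.
(* Shearing by the quotients turns the other coefficients into remainders modulo [c j]. *)
pose t' := shear t j (fun i => c i %/ c j).
have gt' i : inspan t' (g i) by apply: inspan_trans (gt i) => k; apply: sub_shear.
have t'g i : inspan g (t' i) by apply: inspan_trans tg _; apply: shear_sub.
(* The tuple [t'] competes in the same minimisation as [t], so a nonzero coefficient smaller than
   [c j] contradicts minimality. *)
have small e i : B (\sum_i e i *: t' i) -> (size (e i : {poly K}) < size (c j))%N -> e i = 0.
  move=> Be lt_e; apply/eqP/contraT => ei.
  have /asboolP/smin : Q (size (e i)) by exists t', e, i.
  by rewrite -szc leqNgt lt_e.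
have Bct : B (c j *: t' j).
  move: Bc; rewrite (shear_sum t j (fun i => c i %/ c j)) -/t'.
  pose e i := if i == j then c j else c i - c j * (c i %/ c j).
  rewrite -[X in B X]/(\sum_i e i *: t' i) => Be.
  have e0 i : i != j -> e i = 0.
    move=> ij; apply: small => //; rewrite /e (negPf ij).
    rewrite {1}(divp_eq (c i) (c j)) mulrC addrAC subrr add0r ltn_modp //.
  move: Be; rewrite (bigD1 j) //= big1 ?addr0 => [|i /e0->]; last by rewrite scale0r.
  by rewrite /e eqxx.
exists t', j, (c j); split=> // e Be.
rewrite /dvdp; apply/eqP.
(* Subtracting a multiple of [c j *: t' j] reduces the [j]-th coefficient to its remainder, which is
   too small to be nonzero. *)
pose e' i := if i == j then e j %% c j else e i.
have : B (\sum_i e' i *: t' i).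
  have -> : \sum_i e' i *: t' i = \sum_i e i *: t' i - (e j %/ c j) *: (c j *: t' j).
    rewrite (bigD1 j) //= [in RHS](bigD1 j) //= addrAC; congr (_ + _); last first.
      by apply: eq_bigr => i /negPf ij; rewrite /e' ij.
    rewrite /e' eqxx scalerA -scalerBl; congr (_ *: _).
    by rewrite {2}(divp_eq (e j) (c j)) addrAC subrr add0r.
  by apply: BB => //; apply: BZ.
by move=> /(small _ j); rewrite /e' eqxx ltn_modp; apply.
Qed.

(** Induction on the number of generators: either they are free modulo [B], or a relation splits off
    a cyclic summand and one generator fewer remains. *)
Theorem cyclic_decomposition r (g : 'I_r -> A) :
  exists (m n : nat) (h : nat -> A) (xi : nat -> {poly K}),
    [/\ forall k, (k < n)%N -> (1 < size (xi k))%N,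
        forall k, (k < n)%N -> B (xi k *: h (m + k)%N),
        forall c : nat -> {poly K}, B (\sum_(k < m + n) c k *: h k) ->
          (forall k, (k < m)%N -> c k = 0) /\ (forall k, (k < n)%N -> xi k %| c (m + k)%N),
        forall i, inspan (fun k : 'I_(m + n) => h k) (g i) &
        forall k, (k < m + n)%N -> inspan g (h k)].
Proof.
elim: r g => [|r IHr] g.
  by exists 0%N, 0%N, (fun=> 0), (fun=> 0); split=> // [[]].
have [[c [j [Bc cj]]]|free] := pselect (exists c j, B (\sum_i c i *: g i) /\ c j != 0); last first.
  exists r.+1, 0%N, (fun k => g (inord k)), (fun=> 0); split=> //.
  - move=> c; rewrite addn0 => Bc; split=> // k lt_k.
    apply/eqP/contraT => ck; case: free; exists (fun i : 'I_r.+1 => c i), (Ordinal lt_k); split=> //.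
    by rewrite (eq_bigr (fun i : 'I_r.+1 => c i *: g (inord i))) // => i _; rewrite inord_val.
  - rewrite addn0 => i; have := inspan_gen (fun k : 'I_r.+1 => g (inord k)) i.
    by rewrite inord_val.
  - by move=> k _; apply: inspan_gen.
have [t [k [d [d0 Bd dP gt tg]]]] := split_cyclic_summand Bc cj.
have [m [n [h [xi [szxi Bxi indep gh hg]]]]] := IHr (fun i => t (lift k i)).
have ht i : (i < m + n)%N -> inspan t (h i).
  by move=> lt_i; apply: inspan_trans (hg _ lt_i) => l; apply: inspan_gen.
(* A constant [d] is a unit, so [t k] lies in [B] and is dropped; otherwise [t k] is appended as the
   last torsion generator, with annihilator [d]. *)
have [szd|szd] := leqP (size d) 1.
  exists m, n, h, xi; split=> // i; last by move=> lt_i; apply: inspan_trans tg (ht _ lt_i).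
  apply: inspan_trans (gt i) => l.
  have [l' ->|->] := unliftP k l; first exact: gh.
  apply: inspan_B; have := size1_polyC szd; set a := d`_0 => da.
  have a0 : a != 0 by rewrite da polyC_eq0 in d0.
  have := BZ (a^-1)%:P Bd; rewrite da scalerA -polyCM mulVf // scale1r; exact: id.
pose h' i := if i == (m + n)%N then t k else h i.
have h'E i : (i < m + n)%N -> h' i = h i by rewrite /h' => /ltn_eqF->.
have h'mn : h' (m + n)%N = t k by rewrite /h' eqxx.
exists m, n.+1, h', (fun i => if i == n then d else xi i); split.
- by move=> i; rewrite ltnS leq_eqVlt; case: eqP => //= _; apply: szxi.
- move=> i; rewrite ltnS leq_eqVlt; case: eqP => [-> _|_ /= lt_i]; first by rewrite h'mn.
  by rewrite h'E ?ltn_add2l //; apply: Bxi.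
- move=> c'; rewrite addnS big_ord_recr /= h'mn => Bc'.
  have eq_h : \sum_(i < m + n) c' i *: h' i = \sum_(i < m + n) c' i *: h i.
    by apply: eq_bigr => i _; rewrite h'E.
  rewrite eq_h in Bc'.
  have [e Be] : inspan (fun i => t (lift k i)) (\sum_(i < m + n) c' i *: h i).
    by apply: inspan_sum => i _; apply: hg.
  have d_c' : d %| c' (m + n)%N.
    (* Expressing the [h i] through the remaining [t i] turns the relation into one among all the
       [t i], to which [dP] applies. *)
    pose e' i := if unlift k i is Some i' then e i' else c' (m + n)%N.
    suff /dP : B (\sum_i e' i *: t i) by rewrite /e' unlift_none.
    rewrite (bigD1_ord k) //= {1}/e' unlift_none.
    under eq_bigr => i _ do rewrite /e' liftK.
    have eqS (x y z : A) : x + y - (x - z) = y + z by rewrite opprB addrC addrA subrK addrC.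
    by have := BB Bc' Be; rewrite eqS.
  have Bc'' : B (\sum_(i < m + n) c' i *: h i).
    have := BB Bc' (BZ (c' (m + n)%N %/ d) Bd).
    by rewrite scalerA divpK // addrK.
  have [c'm c'n] := indep _ Bc''; split=> // i.
  rewrite ltnS leq_eqVlt; case: eqP => [->|_] //=; exact: c'n.
- move=> i; apply: inspan_trans (gt i) => l.
  have [l' ->|->] := unliftP k l; last first.
    have lt_mn : (m + n < m + n.+1)%N by rewrite addnS.
    by have := inspan_gen (fun i : 'I_(m + n.+1) => h' i) (Ordinal lt_mn); rewrite /= h'mn.
  apply: inspan_trans (gh l') => i'.
  have lt_i' : (i' < m + n.+1)%N by rewrite addnS ltnS ltnW.
  have := inspan_gen (fun i : 'I_(m + n.+1) => h' i) (Ordinal lt_i').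
  by rewrite /= h'E.
- move=> i; rewrite addnS ltnS leq_eqVlt => /predU1P[->|lt_i].
    by rewrite h'mn.
  by rewrite h'E //; apply: inspan_trans tg (ht _ lt_i).
Qed.

End CyclicDecomposition.

(** * Ultrapowers *)

HB.instance Definition _ (L : Lang) (M : Struc L) := gen_eqMixin (dom M).
HB.instance Definition _ (L : Lang) (M : Struc L) := gen_choiceMixin (dom M).

Section Ultrafilter.
Local Open Scope classical_set_scope.
Variables (I : Type) (U : set_system I).
Context {UU : UltraFilter U}.

Lemma ultra_const (P : Prop) : U [set _ | P] <-> P.
Proof. by split=> [/filter_const|HP]; last by apply: filterE. Qed.

Lemma ultraI (A B : set I) : U (A `&` B) <-> U A /\ U B.
Proof.
split=> [UAB|[UA UB]]; last exact: filterI.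
by split; apply: filterS UAB => i [].
Qed.

Lemma ultraC (A : set I) : U (~` A) <-> ~ U A.
Proof.
split=> [UnA UA|nUA]; last by case: (in_ultra_setVsetC A UU).
have: U set0 by rewrite -(setICr A); apply: filterI.
exact: filter_not_empty.
Qed.

Lemma ultraU (A B : set I) : U (A `|` B) <-> U A \/ U B.
Proof.
split=> [UAB|[UA|UB]]; last first.
- by apply: filterS UB => i; right.
- by apply: filterS UA => i; left.
have [UA|/ultraC UnA] := pselect (U A); first by left.
by right; apply: filterS (filterI UAB UnA) => i [[]].
Qed.

Lemma ultra_imply (A B : set I) : U [set i | A i -> B i] <-> (U A -> U B).
Proof.
split=> [UAB UA|UAB]; first by apply: filterS (filterI UAB UA) => i [AB /AB].
have [/UAB|/ultraC] := pselect (U A); first by apply: filterS => i Bi _.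
by apply: filterS => i nAi /nAi.
Qed.

Lemma ultra_forall (J : finType) (A : J -> set I) :
  U [set i | forall j, A j i] <-> forall j, U (A j).
Proof.
split=> [UA j|UA]; first by apply: filterS UA => i.
exact: filter_forall.
Qed.

End Ultrafilter.

(** The sets containing all lists above some fixed list form a proper filter. An ultrafilter above
    it plays the part of compactness: whatever needs finitely many elements in the list holds almost
    everywhere. *)
Lemma finite_subsets_ultrafilter (X : eqType) :
  exists U : set_system (seq X), UltraFilter U /\
    forall x, U [set l | x \in l]%classic.
Proof.
pose F : set_system (seq X) := [set A | exists l0 : seq X, forall l : seq X, {subset l0 <= l} -> A l]%classic.
have FF : ProperFilter F.
  split; first by move=> [l0 /(_ l0)]; apply.
  split=> [|A B [l0 lA] [l1 lB]|A B sAB [l0 lA]]; first by exists [::].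
    exists (l0 ++ l1) => l sl; split; [apply: lA | apply: lB] => x xl; apply: sl.
      by rewrite mem_cat xl.
    by rewrite mem_cat xl orbT.
  by exists l0 => l /lA/sAB.
have [U [UU FU]] := ultraFilterLemma FF.
exists U; split=> // x; apply: FU; exists [:: x] => l; apply; exact: mem_head.
Qed.

Section Ultrapower.
Local Open Scope classical_set_scope.
Variables (I : Type) (U : set_system I).
Context {UU : UltraFilter U}.

Section Quotient.
Variable A : Type.
Definition ueq (f g : I -> A) : Prop := U [set i | f i = g i].

(** The elements are the equivalence classes themselves, as predicates, so that equality in the
    ultrapower is Leibniz equality. *)
Definition up : Type := {S : (I -> A) -> Prop | exists f, S = ueq f}.
Definition cls (f : I -> A) : up := exist _ (ueq f) (ex_intro _ f erefl).
Definition rep (x : up) : I -> A := sval (cid (svalP x)).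

Lemma cls_eq f g : cls f = cls g <-> U [set i | f i = g i].
Proof.
split=> [[eq_fg]|Ufg].
  by rewrite -[U _]/(ueq f g) eq_fg /ueq; apply: filterE.
apply: eq_exist; apply: funext => h; apply: propext; rewrite /ueq.
by split=> Uh; apply: filterS (filterI Ufg Uh) => i []; congruence.
Qed.

Lemma repK x : cls (rep x) = x.
Proof. by case: x => S HS; apply: eq_exist; rewrite /rep; case: cid. Qed.

Lemma rep_cls f : U [set i | rep (cls f) i = f i].
Proof. by apply/cls_eq; rewrite repK. Qed.
End Quotient.

Variables (L : Lang) (M : Struc L).

Definition upower : Struc L := {|
  dom := up M;
  dom_inh := let: inhabits x := dom_inh M in inhabits (cls (fun=> x));
  finterp := fun f args => cls (fun i => finterp (fun j => rep (args j) i));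
  rinterp := fun r args => U [set i | rinterp (fun j => rep (args j) i)] |}.

Lemma cls_fun f (g : 'I_(farity f) -> I -> M) :
  finterp (s := upower) (fun j => cls (g j)) = cls (fun i => finterp (fun j => g j i)).
Proof.
apply/cls_eq.
have Ug : U [set i | forall j, rep (cls (g j)) i = g j i].
  by apply/ultra_forall => j; apply: rep_cls.
by apply: filterS Ug => i eq_i /=; congr finterp; apply: funext => j.
Qed.

Lemma cls_rel r (g : 'I_(rarity r) -> I -> M) :
  rinterp (s := upower) (fun j => cls (g j)) <-> U [set i | rinterp (fun j => g j i)].
Proof.
have Ug : U [set i | forall j, rep (cls (g j)) i = g j i].
  by apply/ultra_forall => j; apply: rep_cls.
split=> Ur; apply: filterS (filterI Ug Ur) => i [/funext eq_i] /=; first by rewrite eq_i.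
by rewrite eq_i.
Qed.

Lemma Los_term (a : nat -> I -> M) (t : term L) :
  eval (M := upower) (fun n => cls (a n)) t = cls (fun i => eval (a^~ i) t).
Proof.
elim: t => [//|f ts IHt].
transitivity (@finterp L upower f (fun j => eval (M := upower) (fun n => cls (a n)) (ts j))) => //.
by rewrite (funext IHt) cls_fun.
Qed.

Lemma upd_cls (a : nat -> I -> M) x (g : I -> M) :
  upd (fun n => cls (a n)) x (cls g) = (fun n => cls (upd a x g n)).
Proof. by apply: funext => n; rewrite /upd; case: eqP. Qed.

Lemma upd_at (a : nat -> I -> M) x (g : I -> M) i :
  (upd a x g)^~ i = upd (a^~ i) x (g i).
Proof. by apply: funext => n; rewrite /upd; case: eqP. Qed.

(** Witnesses are chosen index by index, with a default where none exists. Kept apart from [Los]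
    because the universal case also passes through it, by double negation. *)
Lemma Los_ex (a : nat -> I -> M) x phi :
  (forall a, holds (M := upower) (fun n => cls (a n)) phi <-> U [set i | holds (a^~ i) phi]) ->
  (exists v : upower, holds (M := upower) (upd (fun n => cls (a n)) x v) phi) <->
  U [set i | exists v : M, holds (upd (a^~ i) x v) phi].
Proof.
move=> IH; split=> [[v]|Uv].
  rewrite -(repK v) upd_cls IH; apply: filterS => i /=.
  by rewrite upd_at; exists (rep v i).
have gP i : exists w, (exists v : M, holds (upd (a^~ i) x v) phi) -> holds (upd (a^~ i) x w) phi.
  have [[v av]|nv] := pselect (exists v, holds (upd (a^~ i) x v) phi); first by exists v.
  by exists (a 0%N i).
have [g {}gP] := choice gP.
exists (cls g); rewrite upd_cls IH; apply: filterS Uv => i /= /gP.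
by rewrite upd_at.
Qed.

Theorem Los (a : nat -> I -> M) phi :
  holds (M := upower) (fun n => cls (a n)) phi <-> U [set i | holds (a^~ i) phi].
Proof.
elim: phi a => /=.
- by move=> a; rewrite ultra_const.
- by move=> t1 t2 a; rewrite !Los_term cls_eq.
- move=> r ts a.
  rewrite -[X in X <-> _]/(@rinterp L upower r
    (fun j => eval (M := upower) (fun n => cls (a n)) (ts j))).
  by rewrite (funext (fun j => Los_term a (ts j))) cls_rel.
- by move=> p IH a; rewrite IH -ultraC.
- by move=> p IHp q IHq a; rewrite IHp IHq -ultraI.
- by move=> p IHp q IHq a; rewrite IHp IHq -ultraU.
- by move=> p IHp q IHq a; rewrite IHp IHq -ultra_imply.
- move=> x p IH a.
  have IHn a' : holds (M := upower) (fun n => cls (a' n)) (fNot p) <->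
      U [set i | holds (a'^~ i) (fNot p)] by rewrite /= IH -ultraC.
  have Hex := @Los_ex a x (fNot p) IHn.
  have all_not_ex (N : Struc L) (b : nat -> N) :
      (forall v, holds (upd b x v) p) <-> ~ (exists v, holds (upd b x v) (fNot p)).
    by split=> [H [v]|H v]; [apply; apply: H | apply: contrapT => nH; apply: H; exists v].
  apply: iff_trans (all_not_ex upower _) _; rewrite Hex -ultraC.
  by split; apply: filterS => i /=; [move/(all_not_ex M) | move=> H; apply/(all_not_ex M)].
- by move=> x p IH a; apply: Los_ex.
Qed.

Definition uconst (m : M) : upower := cls (fun=> m).

Lemma uconst_elementary (a : nat -> M) phi :
  holds (M := upower) (uconst \o a) phi <-> holds a phi.
Proof. by rewrite (Los (fun n _ => a n)) ultra_const. Qed.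

Lemma uconst_embedding : embedding (uconst : M -> upower).
Proof.
split.
- by move=> x y /cls_eq/ultra_const.
- by move=> f args; rewrite cls_fun.
- by move=> r args; rewrite cls_rel ultra_const.
Qed.

Lemma upower_model T : fo_model T M -> fo_model T upower.
Proof.
move=> MT phi Tphi a; have -> : a = fun n => cls (rep (a n)).
  by apply: funext => n; rewrite repK.
by apply/Los; apply: filterE => i; apply: MT.
Qed.

End Ultrapower.

(** * Diagrams *)

Section Coincidence.
Variables (L : Lang) (M : Struc L).

Lemma eval_coincide (a b : nat -> M) (t : term L) :
  (forall x, tfree x t -> a x = b x) -> eval a t = eval b t.
Proof.
elim: t => [n|f ts IHt] ab /=; first exact: ab.
by congr finterp; apply: funext => j; apply: IHt => x xt; apply: ab; exists j.
Qed.

Lemma holds_coincide (a b : nat -> M) (phi : formula L) :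
  (forall x, ofree x phi -> a x = b x) -> holds a phi <-> holds b phi.
Proof.
have updE (c d : nat -> M) x (p : formula L) v : (forall y, x <> y /\ ofree y p -> c y = d y) ->
    forall y, ofree y p -> upd c x v y = upd d x v y.
  by move=> cd y yp; rewrite /upd; case: eqP => // /nesym xy; apply: cd.
elim: phi a b => /=.
- by [].
- by move=> t1 t2 a b ab; rewrite !(@eval_coincide a b) // => x xt; apply: ab; [right | left].
- move=> r ts a b ab; suff -> : (fun i => eval a (ts i)) = (fun i => eval b (ts i)) by [].
  by apply: funext => i; apply: eval_coincide => x xt; apply: ab; exists i.
- by move=> p IH a b ab; rewrite (IH a b).
- by move=> p IHp q IHq a b ab; rewrite (IHp a b) ?(IHq a b) // => x xt; apply: ab; [right | left].
- by move=> p IHp q IHq a b ab; rewrite (IHp a b) ?(IHq a b) // => x xt; apply: ab; [right | left].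
- by move=> p IHp q IHq a b ab; rewrite (IHp a b) ?(IHq a b) // => x xt; apply: ab; [right | left].
- by move=> x p IH a b ab; split=> H v; have := H v; apply IH; apply: updE => // y /ab.
- by move=> x p IH a b ab; split=> -[v Hv]; exists v; move: Hv; apply IH; apply: updE => // y /ab.
Qed.

Definition exs (vs : seq nat) (phi : formula L) : formula L := foldr (@fEx L) phi vs.

Lemma exs_existential vs phi : qf phi -> existential (exs vs phi).
Proof. by move=> qf_phi; elim: vs => [|v vs IH] /=; [apply: ex_qf | apply: ex_ex]. Qed.

Lemma ofree_exs x vs phi : ofree x (exs vs phi) -> x \notin vs /\ ofree x phi.
Proof.
elim: vs => //= v vs IH [/eqP xv /IH[xvs xphi]].
by rewrite inE negb_or xvs eq_sym xv.
Qed.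

Lemma holds_exs (a : nat -> M) vs phi :
  holds a (exs vs phi) <-> exists a', {in predC (mem vs), a' =1 a} /\ holds a' phi.
Proof.
elim: vs a => [|v vs IH] a /=.
  split=> [Ha|[a' [a'a]]]; first by exists a.
  by rewrite (_ : a' = a) //; apply: funext => x; apply: a'a.
split=> [[w /IH[a' [a'a Ha']]]|[a' [a'a Ha']]].
  exists a'; split=> // x; rewrite !inE negb_or => /andP[/negPf xv xvs].
  by rewrite a'a // /upd xv.
exists (a' v); apply/IH; exists a'; split=> // x; rewrite !inE => xvs.
rewrite /upd; case: eqP => [->//|/eqP xv]; apply: a'a.
by rewrite !inE negb_or xv.
Qed.

Lemma existential_exs (phi : formula L) :
  existential phi -> exists vs chi, qf chi /\ phi = exs vs chi.
Proof.
elim=> [chi qf_chi|x p _ [vs [chi [qf_chi ->]]]]; first by exists [::], chi.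
by exists (x :: vs), chi.
Qed.

End Coincidence.

(** * Finite parts of the diagram of a structure *)

Inductive fact (L : Lang) (N : Struc L) : Type :=
| FNeq : N -> N -> fact N
| FFun : forall f : Fsym L, ('I_(farity f) -> N) -> fact N
| FRel : forall r : Rsym L, ('I_(rarity r) -> N) -> fact N.

HB.instance Definition _ L N := gen_eqMixin (@fact L N).

Section Facts.
Variables (L : Lang) (N : Struc L).

Definition elems (phi : fact N) : seq N :=
  match phi with
  | FNeq y z => [:: y; z]
  | FFun f args => finterp args :: codom args
  | FRel r args => codom args
  end.

(** A map satisfying every fact is an embedding; [FNeq y z] is injectivity at one pair, and is void
    when [y = z]. *)
Definition sat (M : Struc L) (h : N -> M) (phi : fact N) : Prop :=
  match phi with
  | FNeq y z => h y = h z -> y = z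
  | FFun f args => h (finterp args) = finterp (h \o args)
  | FRel r args => rinterp (h \o args) <-> rinterp args
  end.

Lemma sat_ext (M : Struc L) (h h' : N -> M) phi :
  {in elems phi, h =1 h'} -> sat h phi <-> sat h' phi.
Proof.
case: phi => [y z|f args|r args] /= hh'.
- by rewrite !hh' // !inE eqxx ?orbT.
- rewrite hh' ?mem_head //; suff -> : h \o args = h' \o args by [].
  by apply: funext => i /=; apply: hh'; rewrite inE codom_f orbT.
- suff -> : h \o args = h' \o args by [].
  by apply: funext => i /=; apply: hh'; rewrite codom_f.
Qed.

Definition factform (var : N -> nat) (phi : fact N) : formula L :=
  match phi with
  | FNeq y z => if `[< y = z >] then fNot (fFalse L)
                else fNot (fEq (tvar L (var y)) (tvar L (var z)))
  | FFun f args => fEq (tvar L (var (finterp args))) (tapp (fun i => tvar L (var (args i))))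
  | FRel r args => let A := fRel (fun i => tvar L (var (args i))) in
                   if `[< rinterp args >] then A else fNot A
  end.

Lemma holds_factform (M : Struc L) (a : nat -> M) var phi :
  holds a (factform var phi) <-> sat (a \o var) phi.
Proof.
case: phi => [y z|f args|r args] //=; case: asboolP => //= H.
all: by tauto.
Qed.

Lemma qf_factform var phi : qf (factform var phi).
Proof. by case: phi => [y z|f args|r args] //=; case: asboolP. Qed.

Lemma ofree_factform var phi x :
  ofree x (factform var phi) -> exists2 y, y \in elems phi & x = var y.
Proof.
case: phi => [y z|f args|r args] /=.
- case: asboolP => //= _ [<-|<-]; first by exists y; rewrite ?inE ?eqxx.
  by exists z; rewrite ?inE ?eqxx ?orbT.
- case=> [<-|[i <-]]; first by exists (finterp args); rewrite ?mem_head.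
  by exists (args i); rewrite // inE codom_f orbT.
- by case: asboolP => _ /= [i <-]; exists (args i); rewrite // codom_f.
Qed.

Definition conjform var (l : seq (fact N)) : formula L :=
  foldr (@fAnd L) (fNot (fFalse L)) [seq factform var phi | phi <- l].

Lemma holds_conjform (M : Struc L) (a : nat -> M) var l :
  holds a (conjform var l) <-> forall phi, phi \in l -> sat (a \o var) phi.
Proof.
elim: l => [|phi l IH] /=; first by split=> // _ [].
rewrite IH holds_factform; split=> [[Hphi Hl] psi|H].
  by rewrite inE => /predU1P[->//|/Hl].
by split=> [|psi psil]; apply: H; rewrite inE ?eqxx ?psil ?orbT.
Qed.

Lemma qf_conjform var l : qf (conjform var l).
Proof. by elim: l => //= phi l IH; split=> //; apply: qf_factform. Qed.

Lemma ofree_conjform var l x :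
  ofree x (conjform var l) -> exists2 y, y \in flatten (map elems l) & x = var y.
Proof.
elim: l => //= phi l IH [/ofree_factform|/IH] [y yE ->].
  by exists y => //; rewrite mem_cat yE.
by exists y => //; rewrite mem_cat yE orbT.
Qed.

Section Realize.
Variables (M : Struc L) (e : M -> N) (l : seq (fact N)).
Variables (q : N -> option nat) (fr : nat -> nat).
Hypotheses (e_inj : injective e) (fr_inj : injective fr).
Hypotheses (q_e : forall m, q (e m) = None) (q_fr : forall y v j, q y = Some v -> fr j <> v).

Definition factelems := flatten (map elems l).
Let s := factelems.

Definition varof y := if q y is Some v then v else fr (index y s).

Definition auxvars :=
  [seq fr (index y s) | y <- s & (q y == None) && `[< ~ exists m, e m = y >]].

(* The elements of N occurring in l are named by the reserved variables [q], by
   parameters from M, or else by existentially quantified variables. *)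
Definition diagram_formula := exs auxvars (conjform varof l).

Let fr_index y z : y \in s -> z \in s -> fr (index y s) = fr (index z s) -> y = z.
Proof. by move=> ys zs /fr_inj; apply: index_inj. Qed.

Lemma fr_auxvars m : e m \in s -> fr (index (e m) s) \notin auxvars.
Proof.
move=> ems; apply/negP => /mapP[y]; rewrite mem_filter => /andP[/andP[_ /asboolP ny] ys].
by move=> /fr_index em_y; apply: ny; exists m; apply: em_y.
Qed.

(** The structure [N] is its own witness: each quantified variable takes the element that it
    names. *)
Lemma diagram_holds (b : nat -> N) :
  (forall y v, y \in s -> q y = Some v -> b v = y) ->
  (forall m, e m \in s -> b (fr (index (e m) s)) = e m) ->
  holds b diagram_formula.
Proof.
move=> bq be; apply/holds_exs.
pose Q v y := [/\ y \in s, q y = None & fr (index y s) = v].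
pose b' v := if pselect (exists y, Q v y) is left ex then sval (cid ex) else b v.
have b'v y : y \in s -> b' (varof y) = y.
  rewrite /b' /varof => ys; case qy: (q y) => [v|].
    case: pselect => [ex|_]; last exact: bq.
    by case: (cid ex) => z /= [_ _] /q_fr; case/(_ _ qy).
  case: pselect => [ex|]; last by case; exists y.
  by case: (cid ex) => z /= [zs _ /fr_index]; apply.
exists b'; split.
  move=> v; rewrite inE => vaux; rewrite /b'; case: pselect => // ex.
  case: (cid ex) => y /= [ys qy yv]; have [[m em]|nm] := pselect (exists m, e m = y).
    by rewrite -yv -em be // em.
  case/negP: vaux; rewrite -yv; apply: (map_f (fun y => fr (index y s))).
  by rewrite mem_filter ys qy /= andbT; apply/asboolP.
apply/holds_conjform => phi lphi.
apply/(@sat_ext _ _ id) => [y yphi|].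
  by rewrite /= b'v //; apply/flattenP; exists (elems phi); rewrite ?map_f.
by case: phi {lphi} => [y z|f args|r args] /=; [|reflexivity|split].
Qed.

(** On the image of [e] the map [h] must invert [e], which agrees with the parameters; elsewhere it
    is read off from the reserved variables and the witnesses of the quantifiers. *)
Lemma diagram_realize (a : nat -> M) :
  holds a diagram_formula ->
  (forall m, e m \in s -> a (fr (index (e m) s)) = m) ->
  exists h : N -> M, [/\ forall phi, phi \in l -> sat h phi,
    forall y v, y \in s -> q y = Some v -> h y = a v &
    forall m, h (e m) = m].
Proof.
move=> /holds_exs[a' [a'a /holds_conjform Ha']] ae.
pose h y := if pselect (exists m, e m = y) is left ex then sval (cid ex) else a' (varof y).
have he m : h (e m) = m.
  rewrite /h; case: pselect => [ex|]; last by case; exists m.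
  by case: (cid ex) => m' /= /e_inj.
have hE y : y \in s -> h y = a' (varof y).
  have [[m <-] ms|ny _] := pselect (exists m, e m = y); last by rewrite /h; case: pselect.
  by rewrite he /varof q_e a'a ?ae // inE; apply: fr_auxvars.
exists h; split=> // [phi lphi|y v ys qy].
  apply/(@sat_ext _ _ (a' \o varof)); last exact: Ha'.
  by move=> y yphi; rewrite hE //; apply/flattenP; exists (elems phi); rewrite ?map_f.
rewrite hE // /varof qy a'a // inE; apply/negP => /mapP[z _ zv].
exact: (q_fr (j := index z s) qy).
Qed.

Lemma ofree_diagram x :
  ofree x diagram_formula ->
  (exists2 y, y \in s & q y = Some x) \/ exists j, x = fr j.
Proof.
case/ofree_exs => _ /ofree_conjform[y ys ->]; rewrite /varof.
by case qy: (q y) => [v|]; [left; exists y | right; exists (index y s)].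
Qed.

Lemma parameters_exist : exists p : nat -> M, forall m, e m \in s -> p (fr (index (e m) s)) = m.
Proof.
have [m0] := dom_inh M; pose Q v m := e m \in s /\ fr (index (e m) s) = v.
exists (fun v => if pselect (exists m, Q v m) is left ex then sval (cid ex) else m0) => m ems.
case: pselect => [ex|]; last by case; exists m.
by case: (cid ex) => m' /= [em's /fr_index em]; apply: e_inj; apply: em.
Qed.

End Realize.

(** With no reserved variables the diagram formula of [l] is existential and true in [N], hence true
    in [M], where it is realized. *)
Lemma exists_partial_embedding (M : Struc L) (e : M -> N) : injective e ->
  (forall phi a, existential phi -> holds (e \o a) phi -> holds a phi) ->
  forall l : seq (fact N), exists h : N -> M, (forall phi, phi \in l -> sat h phi) /\
    forall m, h (e m) = m.
Proof.
move=> e_inj ec l; pose q (y : N) : option nat := None.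
have [p pP] := @parameters_exist M e l id e_inj (fun _ _ => id).
have ex_form : existential (diagram_formula e l q id).
  by apply: exs_existential; apply: qf_conjform.
have Np : holds (e \o p) (diagram_formula e l q id).
  by apply: diagram_holds => // m /pP /= ->.
have q_fr (y : N) (v j : nat) : q y = Some v -> id j <> v by [].
by have [h [hl _ he]] := diagram_realize e_inj (fun _ _ => id) (fun=> erefl) q_fr (ec _ _ ex_form Np) pP; exists h.
Qed.

End Facts.

(** * Gluing partial embeddings along an ultrafilter *)

Section DiagramEmbedding.
Variables (L : Lang) (M N : Struc L) (h : seq (fact N) -> N -> M).
Hypothesis h_sat : forall l phi, phi \in l -> sat (h l) phi.
Variable U : set_system (seq (fact N)).
Context {UU : UltraFilter U}.
Hypothesis U_fact : forall phi, U [set l | phi \in l]%classic.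

Definition ultra_map (y : N) : upower U M := cls U (fun l => h l y).

(** Each fact belongs to almost every list [l], and [h l] respects the facts in [l]. *)
Lemma ultra_map_embedding : embedding ultra_map.
Proof.
split.
- move=> y z /cls_eq yz; apply: (@ultra_const _ U _ _).1.
  by apply: filterS (filterI yz (U_fact (FNeq y z))) => l [? /h_sat]; apply.
- move=> f args; rewrite (cls_fun (fun j l => h l (args j))); apply/cls_eq.
  by apply: filterS (U_fact (FFun args)) => l /h_sat.
- move=> r args; rewrite (cls_rel (fun j l => h l (args j))).
  have Ur := U_fact (FRel args).
  split=> [H|H]; first by apply: filterS Ur => l /h_sat; case=> _; apply.
  apply: (@ultra_const _ U _ _).1.
  by apply: filterS (filterI Ur H) => l [/h_sat[+ _]]; apply.
Qed.

Lemma ultra_map_const (e : M -> N) :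
  (forall l m, h l (e m) = m) -> forall m, ultra_map (e m) = uconst U m.
Proof. by move=> he m; apply/cls_eq; apply: filterE => l; apply: he. Qed.

End DiagramEmbedding.

(** * Finitely many facts decide a quantifier-free formula *)

Section FactsOfFormulas.
Variables (L : Lang) (N : Struc L).

Lemma term_facts (b : nat -> N) (t : term L) : exists l : seq (fact N),
  forall (M : Struc L) (h : N -> M), (forall phi, phi \in l -> sat h phi) ->
    eval (h \o b) t = h (eval b t).
Proof.
elim: t => [n|f ts IHt]; first by exists [::].
have [ls lsP] := choice IHt.
exists (FFun (fun i => eval b (ts i)) :: flatten [seq ls i | i <- enum 'I_(farity f)]).
move=> M h hl /=; rewrite (hl (FFun _) (mem_head _ _)); congr finterp.
apply: funext => i /=; apply: lsP => phi phil; apply: hl; rewrite inE; apply/orP; right.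
by apply/flattenP; exists (ls i) => //; apply: map_f; rewrite mem_enum.
Qed.

(** The list records the values of all subterms under [b] together with one fact per atomic formula;
    for an equation an [FNeq] makes its failure persist. *)
Lemma qf_facts (b : nat -> N) (chi : formula L) : qf chi -> exists l : seq (fact N),
  forall (M : Struc L) (h : N -> M), (forall phi, phi \in l -> sat h phi) ->
    holds (h \o b) chi <-> holds b chi.
Proof.
have inl (l1 l2 : seq (fact N)) (P : fact N -> Prop) :
    (forall x, x \in l1 ++ l2 -> P x) -> (forall x, x \in l1 -> P x) /\ (forall x, x \in l2 -> P x).
  by move=> H; split=> x xl; apply: H; rewrite mem_cat xl ?orbT.
elim: chi => //=.
- by exists [::].
- move=> t1 t2 _; have [l1 P1] := term_facts b t1; have [l2 P2] := term_facts b t2.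
  exists (FNeq (eval b t1) (eval b t2) :: (l1 ++ l2)) => M h hl.
  have /inl[h1 h2] phi : phi \in l1 ++ l2 -> sat h phi.
    by move=> phil; apply: hl; rewrite inE phil orbT.
  by rewrite P1 // P2 //; split=> [/(hl (FNeq _ _) (mem_head _ _))|->].
- move=> r ts _; have [ls lsP] := choice (fun i => term_facts b (ts i)).
  exists (FRel (fun i => eval b (ts i)) :: flatten [seq ls i | i <- enum 'I_(rarity r)]).
  move=> M h hl.
  suff -> : (fun i => eval (h \o b) (ts i)) = h \o (fun i => eval b (ts i)).
    exact: (hl (FRel _) (mem_head _ _)).
  apply: funext => i /=; apply: lsP => phi phil; apply: hl; rewrite inE; apply/orP; right.
  by apply/flattenP; exists (ls i) => //; apply: map_f; rewrite mem_enum.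
- by move=> p IH /IH[l lP]; exists l => M h /lP ->.
- move=> p IHp q IHq [/IHp[l1 P1] /IHq[l2 P2]]; exists (l1 ++ l2) => M h /inl[h1 h2].
  by rewrite P1 // P2.
- move=> p IHp q IHq [/IHp[l1 P1] /IHq[l2 P2]]; exists (l1 ++ l2) => M h /inl[h1 h2].
  by rewrite P1 // P2.
- move=> p IHp q IHq [/IHp[l1 P1] /IHq[l2 P2]]; exists (l1 ++ l2) => M h /inl[h1 h2].
  by rewrite P1 // P2.
Qed.

End FactsOfFormulas.

(** * The definable vector space *)

Section DefinableSpace.
Variables (L : Lang) (K : fieldType) (D : VSdef L K).

(** The vector space axioms are stated for the [epsilon]-chosen operations, the ones in which the
    theorem is phrased. *)
Record is_vs (M : Struc L) : Prop := {
  vs0 : inV D (vzero D M);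
  vsD : forall x y : M, inV D x -> inV D y -> inV D (vadd D x y);
  vsZ : forall c (x : M), inV D x -> inV D (vsmul D c x);
  vs_add : forall x y w : M, holds (env3 x y w) (fAdd D) <-> [/\ inV D x, inV D y & w = vadd D x y];
  vs_smul : forall c (x y : M), holds (env3 x y y) (fSmul D c) <-> inV D x /\ y = vsmul D c x;
  vs_addA : forall x y w : M, inV D x -> inV D y -> inV D w ->
    vadd D x (vadd D y w) = vadd D (vadd D x y) w;
  vs_addC : forall x y : M, inV D x -> inV D y -> vadd D x y = vadd D y x;
  vs_add0 : forall x : M, inV D x -> vadd D (vzero D M) x = x;
  vs_addN : forall x : M, inV D x -> vadd D x (vsmul D (-1) x) = vzero D M;
  vs_smulDr : forall c (x y : M), inV D x -> inV D y ->
    vsmul D c (vadd D x y) = vadd D (vsmul D c x) (vsmul D c y);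
  vs_smulDl : forall c d (x : M), inV D x ->
    vsmul D (c + d) x = vadd D (vsmul D c x) (vsmul D d x);
  vs_smulA : forall c d (x : M), inV D x -> vsmul D (c * d) x = vsmul D c (vsmul D d x);
  vs_smul1 : forall x : M, inV D x -> vsmul D 1 x = x }.

(** On V each [epsilon] has a single candidate, since the formulas define graphs and a neutral
    element is unique; so the chosen operations are the given ones. *)
Lemma defines_vs_is_vs T (M : Struc L) : defines_vs D T -> fo_model T M -> is_vs M.
Proof.
move=> [_ [_ [_ HV]]] /HV[add [smul [z [z0 [clD [clZ [addE [smulE
  [addA [addC [add0 [addN [smulDr [smulDl [smulA [smul1 _]]]]]]]]]]]]]]]].
have vaddE x y : inV D x -> inV D y -> vadd D x y = add x y.
  move=> Vx Vy; rewrite /vadd.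
  have ex : exists w : M, inV D w /\ holds (env3 x y w) (fAdd D).
    by exists (add x y); split; [apply: clD | apply/addE].
  by have [_ /addE[]] := ClassicalEpsilon.epsilon_spec (dom_inh M) _ ex.
have vsmulE c x : inV D x -> vsmul D c x = smul c x.
  move=> Vx; rewrite /vsmul.
  have ex : exists w : M, inV D w /\ holds (env3 x w w) (fSmul D c).
    by exists (smul c x); split; [apply: clZ | apply/smulE].
  by have [_ /smulE[]] := ClassicalEpsilon.epsilon_spec (dom_inh M) _ ex.
have vzeroE : vzero D M = z.
  rewrite /vzero; have ex : exists w : M, inV D w /\ forall x : M, inV D x -> vadd D x w = x.
    by exists z; split=> // x Vx; rewrite vaddE // addC // add0.
  have [Vw /(_ _ z0)] := ClassicalEpsilon.epsilon_spec (dom_inh M) _ ex.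
  by rewrite vaddE // add0.
split; rewrite ?vzeroE //.
- by move=> x y Vx Vy; rewrite vaddE //; apply: clD.
- by move=> c x Vx; rewrite vsmulE //; apply: clZ.
- by move=> x y w; rewrite addE; split=> -[Vx Vy ->]; split; rewrite // vaddE.
- by move=> c x y; rewrite smulE; split=> -[Vx ->]; split; rewrite // vsmulE.
- by move=> x y w Vx Vy Vw; rewrite !vaddE ?addA //; apply: clD.
- by move=> x y Vx Vy; rewrite !vaddE ?(addC x).
- by move=> x Vx; rewrite vaddE ?add0.
- by move=> x Vx; rewrite vsmulE // vaddE ?addN //; apply: clZ.
- by move=> c x y Vx Vy; rewrite !vsmulE ?vaddE ?smulDr //; do ?[apply: clZ | apply: clD].
- by move=> c d x Vx; rewrite !vsmulE ?vaddE ?smulDl //; apply: clZ.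
- by move=> c d x Vx; rewrite !vsmulE ?smulA //; apply: clZ.
- by move=> x Vx; rewrite vsmulE ?smul1.
Qed.

(** The proof [W] is part of the type so that the module instances can be found from it. *)
Definition vsp (M : Struc L) (W : is_vs M) : Type := {x : M | inV D x}.

Section Space.
Variables (M : Struc L) (W : is_vs M).
Local Notation V := (vsp W).

HB.instance Definition _ := gen_eqMixin V.
HB.instance Definition _ := gen_choiceMixin V.

Lemma vsp_inj (x y : V) : sval x = sval y -> x = y.
Proof. by case: x y => [x Vx] [y Vy] /= xy; apply: eq_exist. Qed.

Definition vsp_zero : V := exist _ _ (vs0 W).
Definition vsp_add (x y : V) : V := exist _ _ (vsD W (svalP x) (svalP y)).
Definition vsp_smul c (x : V) : V := exist _ _ (vsZ W c (svalP x)).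
Definition vsp_opp (x : V) : V := vsp_smul (-1) x.

Fact vsp_addA : associative vsp_add.
Proof. by move=> x y z; apply: vsp_inj; apply: vs_addA; try apply: svalP. Qed.
Fact vsp_addC : commutative vsp_add.
Proof. by move=> x y; apply: vsp_inj; apply: vs_addC; try apply: svalP. Qed.
Fact vsp_add0 : left_id vsp_zero vsp_add.
Proof. by move=> x; apply: vsp_inj; apply: vs_add0; try apply: svalP. Qed.
Fact vsp_addN : left_inverse vsp_zero vsp_opp vsp_add.
Proof. by move=> x; rewrite vsp_addC; apply: vsp_inj; apply: vs_addN; try apply: svalP. Qed.
HB.instance Definition _ := GRing.isZmodule.Build V vsp_addA vsp_addC vsp_add0 vsp_addN.

Fact vsp_smulA c d (x : V) : vsp_smul c (vsp_smul d x) = vsp_smul (c * d) x.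
Proof. by apply: vsp_inj => /=; rewrite vs_smulA //; apply: svalP. Qed.
Fact vsp_smul1 : left_id 1 vsp_smul.
Proof. by move=> x; apply: vsp_inj; apply: vs_smul1; try apply: svalP. Qed.
Fact vsp_smulDr : right_distributive vsp_smul +%R.
Proof. by move=> c x y; apply: vsp_inj; apply: vs_smulDr; try apply: svalP. Qed.
Fact vsp_smulDl (x : V) : {morph vsp_smul^~ x : c d / c + d}.
Proof. by move=> c d; apply: vsp_inj; apply: vs_smulDl; try apply: svalP. Qed.
HB.instance Definition _ := GRing.Zmodule_isLmodule.Build K V
  vsp_smulA vsp_smul1 vsp_smulDr vsp_smulDl.

Definition toV (x : M) : V := if pselect (inV D x) is left Vx then exist _ x Vx else 0.

Lemma val_toV x : inV D x -> sval (toV x) = x.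
Proof. by rewrite /toV; case: pselect. Qed.

Lemma val_vsum n (f : nat -> V) : vsum D n (fun i => sval (f i)) = sval (\sum_(i < n) f i).
Proof.
rewrite -(big_mkord xpredT) /index_iota subn0 /vsum.
by elim: (iota 0 n) => [|i s IH]; rewrite ?big_nil ?big_cons //= IH.
Qed.

End Space.

Record vlinear (M N : Struc L) (h : M -> N) : Prop := {
  vlin_V : forall x, inV D x -> inV D (h x);
  vlinD : forall x y, inV D x -> inV D y -> h (vadd D x y) = vadd D (h x) (h y);
  vlinZ : forall c x, inV D x -> h (vsmul D c x) = vsmul D c (h x) }.

Section Lift.
Variables (M N : Struc L) (WM : is_vs M) (WN : is_vs N) (h : M -> N) (hlin : vlinear h).

Definition vlift (x : vsp WM) : vsp WN := exist _ _ (vlin_V hlin (svalP x)).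

Fact vlift_is_linear : linear vlift.
Proof.
move=> c x y; apply: vsp_inj => /=.
by rewrite (vlinD hlin) ?(vlinZ hlin) //; do ?[apply: vsZ | apply: svalP].
Qed.
HB.instance Definition _ := GRing.isLinear.Build K (vsp WM) (vsp WN) *:%R vlift vlift_is_linear.

End Lift.
Arguments vlift {M N} WM WN {h} hlin x.

Lemma val_iter (M : Struc L) (W : is_vs M) (th : M -> M) (H : vlinear th) i (x : vsp W) :
  sval (iter i (vlift W W H) x) = iter i th (sval x).
Proof. by elim: i => //= i <-. Qed.

Lemma val_pact (M : Struc L) (W : is_vs M) (th : M -> M) (H : vlinear th) rho (x : vsp W) :
  polyact D th rho (sval x) = sval (pact (vlift W W H) rho x).
Proof.
rewrite /pact /pl -(val_vsum (size rho) (fun i => rho`_i *: iter i (vlift W W H) x)).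
rewrite /polyact; congr vsum; apply: funext => i.
by rewrite -(val_iter H).
Qed.

Definition elementary (M N : Struc L) (e : M -> N) :=
  forall (phi : formula L) a, holds a phi <-> holds (e \o a) phi.

Section Elementary.
Variables (M N : Struc L) (WM : is_vs M) (WN : is_vs N) (e : M -> N) (He : elementary e).

Lemma comp_env3 (x y z : M) : e \o env3 x y z = env3 (e x) (e y) (e z).
Proof. by apply: funext => -[|[|n]]. Qed.

Lemma elementary_inV x : inV D (e x) <-> inV D x.
Proof. by rewrite /inV (He _ (env3 x x x)) comp_env3. Qed.

(** The operations have definable graphs, and elementary maps preserve definable relations. *)
Lemma elementary_vlinear : vlinear e.
Proof.
split=> [x /elementary_inV //|x y Vx Vy|c x Vx].
  have := (vs_add WM x y (vadd D x y)).2; rewrite (He _ (env3 _ _ _)) comp_env3.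
  by case/(_ (And3 Vx Vy erefl))/(vs_add WN).
have := (vs_smul WM c x (vsmul D c x)).2; rewrite (He _ (env3 _ _ _)) comp_env3.
by case/(_ (conj Vx erefl))/(vs_smul WN).
Qed.

Lemma elementary_vzero : e (vzero D M) = vzero D N.
Proof.
have := linear0 (vlift WM WN elementary_vlinear).
by move/(congr1 sval).
Qed.

End Elementary.

Section UltraSpace.
Local Open Scope classical_set_scope.
Variables (I : Type) (U : set_system I).
Context {UU : UltraFilter U}.
Variables (M : Struc L) (W : is_vs M) (W' : is_vs (upower U M)).

Lemma cls_inV (f : I -> M) : inV D (cls U f : upower U M) <-> U [set i | inV D (f i)].
Proof.
rewrite /inV -(Los (fun n i => env3 (f i) (f i) (f i) n)).
suff -> : (fun n => cls U (fun i => env3 (f i) (f i) (f i) n)) = env3 (cls U f) (cls U f) (cls U f) by [].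
by apply: funext => -[|[|n]].
Qed.

Definition clsV (f : I -> vsp W) : vsp W' := toV W' (cls U (fun i => sval (f i))).

Lemma val_clsV f : sval (clsV f) = cls U (fun i => sval (f i)).
Proof. by rewrite val_toV //; apply/cls_inV; apply: filterE => i; apply: svalP. Qed.

(** A representative lies in V at almost every index; at the others [toV] replaces it by 0. *)
Lemma clsV_surj x : exists f, x = clsV f.
Proof.
exists (fun i => toV W (rep (sval x) i)); apply: vsp_inj; rewrite val_clsV.
rewrite -[LHS]repK; apply/cls_eq.
have /cls_inV : inV D (cls U (rep (sval x)) : upower U M) by rewrite repK; apply: svalP.
by apply: filterS => i Vx /=; rewrite val_toV.
Qed.

Lemma clsV_eq f g : clsV f = clsV g <-> U [set i | f i = g i].
Proof.
split=> [/(congr1 sval)|Ufg].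
  by rewrite !val_clsV => /cls_eq; apply: filterS => i /vsp_inj.
by apply: vsp_inj; rewrite !val_clsV; apply/cls_eq; apply: filterS Ufg => i /= ->.
Qed.

(** Los's theorem for the graph formulas [fAdd] and [fSmul]. *)
Lemma clsV_lin c f g : clsV (fun i => c *: f i + g i) = c *: clsV f + clsV g.
Proof.
have addE f' g' : clsV (fun i => f' i + g' i) = clsV f' + clsV g'.
  apply: vsp_inj => /=; rewrite !val_clsV.
  have [] // := (vs_add W' (cls U (fun i => sval (f' i))) (cls U (fun i => sval (g' i)))
     (cls U (fun i => sval (f' i + g' i)))).1.
  pose a n i := env3 (sval (f' i)) (sval (g' i)) (sval (f' i + g' i)) n.
  have /(Los a) : U [set i | holds (a^~ i) (fAdd D)].
    apply: filterE => i; apply: (vs_add W _ _ _).2; split=> //; exact: svalP.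
  suff -> : (fun n => cls U (a n)) = env3 (cls U (fun i => sval (f' i)))
    (cls U (fun i => sval (g' i))) (cls U (fun i => sval (f' i + g' i))) by [].
  by apply: funext => -[|[|n]].
rewrite addE; congr (_ + _); apply: vsp_inj => /=; rewrite !val_clsV.
have [] // := (vs_smul W' c (cls U (fun i => sval (f i))) (cls U (fun i => sval (c *: f i)))).1.
pose a n i := env3 (sval (f i)) (sval (c *: f i)) (sval (c *: f i)) n.
have /(Los a) : U [set i | holds (a^~ i) (fSmul D c)].
  apply: filterE => i; apply: (vs_smul W _ _ _).2; split=> //; exact: svalP.
suff -> : (fun n => cls U (a n)) = env3 (cls U (fun i => sval (f i)))
  (cls U (fun i => sval (c *: f i))) (cls U (fun i => sval (c *: f i))) by [].
by apply: funext => -[|[|n]].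
Qed.

Lemma clsV0 : clsV (fun=> 0) = 0.
Proof.
have := clsV_lin (-1) (fun=> 0) (fun=> 0).
by under eq_fun => i do rewrite scaler0 addr0; rewrite scaleN1r addNr.
Qed.

Lemma clsVD f g : clsV (fun i => f i + g i) = clsV f + clsV g.
Proof.
have := clsV_lin 1 f g; rewrite scale1r => <-.
by congr clsV; apply: funext => i; rewrite scale1r.
Qed.

Lemma clsV_sum n (c : nat -> K) (x : nat -> I -> vsp W) :
  clsV (fun i => \sum_(k < n) c k *: x k i) = \sum_(k < n) c k *: clsV (x k).
Proof.
elim: n => [|n IH].
  by rewrite big_ord0 -clsV0; congr clsV; apply: funext => i; rewrite big_ord0.
rewrite big_ord_recr /= -IH addrC -clsV_lin.
by congr clsV; apply: funext => i; rewrite big_ord_recr /= addrC.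
Qed.

Lemma clsV_pl (x : nat -> I -> vsp W) p :
  clsV (fun i => pl (x^~ i) p) = pl (fun k => clsV (x k)) p.
Proof. exact: clsV_sum. Qed.

Lemma clsV_sumpl n (x : nat -> nat -> I -> vsp W) (p : nat -> {poly K}) :
  clsV (fun i => \sum_(k < n) pl (fun j => x k j i) (p k)) =
  \sum_(k < n) pl (fun j => clsV (x k j)) (p k).
Proof.
elim: n => [|n IH].
  by rewrite big_ord0 -clsV0; congr clsV; apply: funext => i; rewrite big_ord0.
rewrite big_ord_recr /= -IH -clsV_pl -clsVD.
by congr clsV; apply: funext => i; rewrite big_ord_recr.
Qed.

End UltraSpace.

End DefinableSpace.
Arguments vlift {L K D M N} WM WN {h} hlin x.

(** * Existentially closed models solve the systems *)

Section Placeholders.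

Lemma pkidx_pv k i : pkidx (pv k i) = k.
Proof.
rewrite /pkidx /pv lognM ?expn_gt0 ?addn1 // pfactorK // logn_coprime ?addn0 //.
by rewrite coprime2n /= mul2n odd_double.
Qed.

Lemma pidx_pv k i : pidx (pv k i) = i.
Proof.
have := pkidx_pv k i; rewrite /pidx /pkidx => ->.
by rewrite /pv mulKn ?expn_gt0 // addn1 /= mul2n doubleK.
Qed.

Lemma pv_gt0 k i : (0 < pv k i)%N.
Proof. by rewrite /pv addn1 muln_gt0 expn_gt0. Qed.

Lemma pv_inj k i k' i' : pv k i = pv k' i' -> k = k' /\ i = i'.
Proof. by move=> E; split; [rewrite -(pkidx_pv k i) E pkidx_pv | rewrite -(pidx_pv k i) E pidx_pv]. Qed.

Lemma pv_idx v : (0 < v)%N -> pv (pkidx v) (pidx v) = v.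
Proof.
move=> v_gt0; rewrite /pv /pidx /pkidx.
have dvd2 := pfactor_dvdnn 2 v.
set w := (v %/ 2 ^ logn 2 v)%N.
have w_odd : odd w by have := pfactor_coprime (isT : prime 2) v_gt0;
  rewrite -coprime2n => -[m Hm vE]; rewrite /w {1}vE mulnK ?expn_gt0.
have -> : (2 * (w.-1)./2 + 1 = w)%N.
  by rewrite addn1 mul2n; case: (w) w_odd => //= u /even_halfK ->.
by rewrite mulnC /w divnK.
Qed.

Variables (M : Type) (X : nat -> nat -> M) (N : nat) (p : nat -> M).

Lemma ph_pv k i : (k < N)%N -> ph X N p (pv k i) = X k i.
Proof. by move=> lt_k; rewrite /ph pv_gt0 pkidx_pv lt_k pidx_pv. Qed.

(** The variables of block [N] are not placeholders; they will name parameters and quantified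
    elements in diagram formulas. *)
Lemma ph_param j : ph X N p (pv N j) = p (pv N j).
Proof. by rewrite /ph pkidx_pv ltnn andbF. Qed.

Lemma ph_ext Y : (forall k i, (k < N)%N -> X k i = Y k i) -> ph X N p = ph Y N p.
Proof. by move=> XY; apply: funext => v; rewrite /ph; case: ifP => // /andP[_ /XY->]. Qed.

Lemma ph_comp (M' : Type) (e : M -> M') : e \o ph X N p = ph (fun k i => e (X k i)) N (e \o p).
Proof. by apply: funext => v; rewrite /ph /=; case: ifP. Qed.

End Placeholders.

Section Equations.
Variables (L : Lang) (K : fieldType) (D : VSdef L K).

Lemma vsum_ext (M : Struc L) n (f g : nat -> M) :
  (forall i, (i < n)%N -> f i = g i) -> vsum D n f = vsum D n g.
Proof.
move=> fg; rewrite /vsum; congr foldr; apply/eq_in_map => i.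
by rewrite mem_iota => /fg.
Qed.

Variables (M : Struc L) (W : is_vs D M).

Lemma val_dep N B (a : nat -> nat -> K) (X : nat -> nat -> vsp W) :
  vsum D N (fun k => vsum D B (fun i => vsmul D (a k i) (sval (X k i)))) =
  sval (\sum_(k < N) \sum_(i < B) a k i *: X k i).
Proof.
rewrite -(val_vsum N (fun k => \sum_(i < B) a k i *: X k i)); apply: vsum_ext => k _.
by rewrite -(val_vsum B (fun i => a k i *: X k i)).
Qed.

Lemma val_polyeq (th : M -> M) (H : vlinear D th) m (xi : {poly K}) (P : nat -> {poly K})
    (Y : nat -> vsp W) (y v : vsp W) :
  polyact D th xi (sval y) =
    vadd D (vsum D m (fun l => polyact D th (P l) (sval (Y l)))) (sval v) <->
  pact (vlift W W H) xi y = \sum_(l < m) pact (vlift W W H) (P l) (Y l) + v.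
Proof.
rewrite (val_pact H).
have -> : vsum D m (fun l => polyact D th (P l) (sval (Y l))) =
    sval (\sum_(l < m) pact (vlift W W H) (P l) (Y l)).
  rewrite -(val_vsum m (fun l => pact (vlift W W H) (P l) (Y l))); apply: vsum_ext => l _.
  by rewrite (val_pact H).
by split=> [E|->//]; apply: vsp_inj.
Qed.

End Equations.

(** * Generic realizations *)

Section GenericTuple.
Variables (L : Lang) (K : fieldType) (D : VSdef L K) (M : Struc L) (W : is_vs D M).
Variables (N : nat) (phi : formula L) (p : nat -> M).

(* A nontrivial dependency: [\sum_k pl (x k) (c k) = v], the coefficients of the
   k-th block of placeholders being collected in one polynomial. *)
Let dep := ((nat -> {poly K}) * vsp W)%type.
Let nontriv (d : dep) := exists2 k, (k < N)%N & d.1 k != 0.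

(** Otherwise the nontrivial members of [l] would form a disjunction of the kind excluded by
    [no_lin_dep]. *)
Lemma avoid_dependencies (l : seq dep) : no_lin_dep D N phi p ->
  exists X : nat -> nat -> vsp W, holds (ph (fun k i => sval (X k i)) N p) phi /\
    forall d, d \in l -> nontriv d -> \sum_(k < N) pl (X k) (d.1 k) <> d.2.
Proof.
move=> nld; apply: contrapT => noX; apply: nld.
pose l' := [seq d <- l | `[< nontriv d >]].
pose d0 : dep := (fun=> 0, 0).
(* [no_lin_dep] asks for one bound on the placeholder indices of all the equations. *)
pose B := \max_(d <- l') \max_(k < N) size (d.1 k).
have sizeB d k : d \in l' -> (k < N)%N -> (size (d.1 k) <= B)%N.
  move=> dl' lt_k; rewrite /B (big_rem d dl') /= leq_max; apply/orP; left.
  exact: (leq_bigmax (Ordinal lt_k)).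
exists (size l'), B, (fun j k i => ((nth d0 l' j).1 k)`_i), (fun j => sval (nth d0 l' j).2).
split=> [j lt_j|X VX HX].
  have dl' := mem_nth d0 lt_j; split; first exact: svalP.
  have := dl'; rewrite mem_filter => /andP[/asboolP[k lt_k nz] _].
  (* The leading coefficient of a nonzero block is the required nonzero coefficient. *)
  exists k, (size ((nth d0 l' j).1 k)).-1; split=> //; last by rewrite lead_coef_eq0.
  by rewrite prednK ?size_poly_gt0 //; apply: sizeB.
pose X' k i := toV W (X k i).
have X'E k i : (k < N)%N -> sval (X' k i) = X k i by move=> lt_k; rewrite val_toV //; apply: VX.
apply: contrapT => none; apply: noX; exists X'; split.
  by rewrite (ph_ext _ (Y := X)).
move=> d dl nd eq_d; apply: none.
have dl' : d \in l' by rewrite mem_filter dl andbT; apply/asboolP.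
exists (index d l'); rewrite index_mem; split=> //; rewrite nth_index //.
rewrite -eq_d; transitivity (vsum D N (fun k => vsum D B (fun i => vsmul D (d.1 k)`_i (sval (X' k i))))).
  by apply: vsum_ext => k lt_k; apply: vsum_ext => i _; rewrite X'E.
rewrite (val_dep N B (fun k i => (d.1 k)`_i)); congr sval; apply: eq_bigr => k _.
by rewrite (@pl_bound _ _ _ _ B) // sizeB.
Qed.

(** A tuple is chosen for every finite list of dependencies; each single dependency belongs to
    almost every list and so fails almost everywhere. *)
Lemma generic_tuple : no_lin_dep D N phi p ->
  exists (I : Type) (U : set_system I) (X : I -> nat -> nat -> vsp W),
    [/\ UltraFilter U, forall i, holds (ph (fun k j => sval (X i k j)) N p) phi &
      forall c v, (exists2 k, (k < N)%N & c k != 0) ->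
        U [set i | \sum_(k < N) pl (X i k) (c k) <> v]%classic].
Proof.
move=> nld; have [X XP] := choice (fun l => @avoid_dependencies l nld).
have [U [UU Ud]] := finite_subsets_ultrafilter dep.
exists (seq dep), U, X; split=> // [l|c v nz]; first by have [] := XP l.
apply: filterS (Ud (c, v)) => l dl; have [_ Xl] := XP l.
exact: (Xl (c, v)).
Qed.

End GenericTuple.

(** * An endomorphism with prescribed polynomial equations *)

Section Companion.
Variables (K : fieldType) (V0 V : lmodType K) (e : {linear V0 -> V}) (f0 : {linear V0 -> V0}).
Variables (m n : nat) (x : nat -> nat -> V).
Variables (xi : nat -> {poly K}) (P : nat -> nat -> {poly K}) (v : nat -> V0).
Hypothesis e_inj : injective e.
Hypothesis x_free : forall (c : nat -> {poly K}) u, \sum_(k < m + n) pl (x k) (c k) = e u ->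
  forall k, (k < m + n)%N -> c k = 0.
Hypothesis xi_deg : forall k, (k < n)%N -> (0 < (size (xi k)).-1)%N.

Let d k := (size (xi k)).-1.
(** The [k]-th equation solved for its leading iterate. *)
Let target k := (lead_coef (xi k))^-1 *:
  (\sum_(l < m) pl (x l) (P k l) + e (v k) - \sum_(i < d k) (xi k)`_i *: x (m + k)%N i).
(** The intended image of [x k i]. In a torsion block the shift stops at the last index below the
    degree; vectors of larger index receive [target] as a default. *)
Let y k i := if (k < m)%N || (i.+1 < d (k - m))%N then x k i.+1 else target (k - m).

(* The endomorphism shifts each free block [x k]; on a torsion block the last
   basis vector is sent to the combination imposed by the equation. *)
Lemma companion_extension : exists f : {linear V -> V},
  [/\ forall u, f (e u) = e (f0 u),
      forall k i, (k < m + n)%N -> (k < m)%N || (i < d (k - m))%N -> iter i f (x k 0%N) = x k i &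
      forall k, (k < n)%N -> pact f (xi k) (x (m + k)%N 0%N) =
        \sum_(l < m) pact f (P k l) (x l 0%N) + e (v k)].
Proof.
(* The intended graph on the span of the image of [e] and all the [x k i]; it is functional because
   [x_free] determines the coefficients. *)
pose G : set (V * V) := [set z | exists u (c : nat -> {poly K}), z =
  (e u + \sum_(k < m + n) pl (x k) (c k), e (f0 u) + \sum_(k < m + n) pl (y k) (c k))]%classic.
have [||| f fG] := @linear_extension K V V G.
- exists 0, (fun=> 0); rewrite !linear0 !big1 ?addr0 // => k _; exact: linear0.
- move=> a _ _ [u [c ->]] [u' [c' ->]]; exists (a *: u + u'), (fun k => a *: c k + c' k).
  have sumE z : \sum_(k < m + n) pl (z k) (a *: c k + c' k) =
      a *: \sum_(k < m + n) pl (z k) (c k) + \sum_(k < m + n) pl (z k) (c' k) :> V.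
    by rewrite scaler_sumr -big_split /=; apply: eq_bigr => k _; rewrite linearP.
  by congr (_, _) => /=; rewrite !sumE !linearP scalerDr addrACA.
- move=> w [u [c [E ->]]].
  have Ec : \sum_(k < m + n) pl (x k) (c k) = e (- u).
    by apply/eqP; rewrite linearN -addr_eq0 addrC -E.
  have c0 := x_free Ec.
  have sum0 (z : nat -> nat -> V) : \sum_(k < m + n) pl (z k) (c k) = 0.
    by rewrite big1 // => k _; rewrite c0 // linear0.
  have u0 : u = 0 by apply: e_inj; rewrite linear0 E sum0 addr0.
  by rewrite sum0 u0 !linear0 addr0.
have fe u : f (e u) = e (f0 u).
  apply: fG; exists u, (fun=> 0); rewrite !big1 ?addr0 // => k _; exact: linear0.
have fx k i : (k < m + n)%N -> f (x k i) = y k i.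
  move=> lt_k; apply: fG; exists 0, (fun j => if j == k then 'X^i else 0).
  have sumE (z : nat -> nat -> V) :
      \sum_(j < m + n) pl (z j) (if (j : nat) == k then 'X^i else 0) = z k i.
    rewrite (bigD1 (Ordinal lt_k)) //= eqxx pl_Xn big1 ?addr0 // => j jk.
    by rewrite ifN ?linear0.
  by rewrite !sumE !linear0 !add0r.
have iter_x k i : (k < m + n)%N -> (k < m)%N || (i < d (k - m))%N -> iter i f (x k 0%N) = x k i.
  move=> lt_k; elim: i => //= i IH valid; rewrite IH ?fx // /y ?valid //.
  by case/orP: valid => [->//|/ltnW ->]; rewrite orbT.
exists f; split=> // k lt_k.
have sz : size (xi k) = (d k).+1 by rewrite /d; case: (size (xi k)) (xi_deg lt_k).
rewrite /pact {1}/pl sz big_ord_recr /=.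
have iter_xk i : (i < d k)%N -> iter i f (x (m + k)%N 0%N) = x (m + k)%N i.
  by move=> lt_i; apply: iter_x; rewrite ?ltn_add2l // addKn lt_i orbT.
under eq_bigr => i _ do rewrite iter_xk //.
have -> : iter (d k) f (x (m + k)%N 0%N) = target k.
  have dk := xi_deg lt_k; rewrite -/(d k) in dk.
  rewrite -(prednK dk) iterS iter_xk ?prednK // fx ?ltn_add2l // /y addKn prednK //.
  by rewrite ltnn ltnNge leq_addr.
have -> : (xi k)`_(d k) = lead_coef (xi k) by [].
rewrite /target scalerA divff ?scale1r; last first.
  by rewrite lead_coef_eq0 -size_poly_gt0 sz.
rewrite addrC subrK; congr (_ + _); apply: eq_bigr => l _.
by apply: pl_ext => i _; rewrite iter_x ?ltn_ord // ltn_addr.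
Qed.

End Companion.

Lemma Ttheta_vlinear (L : Lang) (K : fieldType) (D : VSdef L K) (T : formula L -> Prop)
  (M : Struc L) (th : M -> M) : Ttheta_model D T th -> vlinear D th.
Proof. by case=> _ thV thD thZ _; split. Qed.

Section UltraPolynomials.
Variables (L : Lang) (K : fieldType) (D : VSdef L K).
Variables (I : Type) (U : set_system I).
Context {UU : UltraFilter U}.
Variables (M : Struc L) (W : is_vs D M) (W' : is_vs D (upower U M)).

Lemma uconst_elem : elementary (@uconst I U L M).
Proof. by move=> phi a; split=> /uconst_elementary. Qed.

Lemma vlift_uconst (H : vlinear D (@uconst I U L M)) (u : vsp W) :
  vlift W W' H u = clsV W' (fun=> u).
Proof. by apply: vsp_inj; rewrite val_clsV. Qed.

Lemma clsV_pact (f : {linear vsp W -> vsp W}) p (Y : I -> vsp W) :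
  clsV W' (fun l => pact f p (Y l)) = pl (fun i => clsV W' (fun l => iter i f (Y l))) p.
Proof. exact: (clsV_pl W' (fun k l => iter k f (Y l))). Qed.

Lemma clsV_sum1 n (x : nat -> I -> vsp W) :
  clsV W' (fun i => \sum_(k < n) x k i) = \sum_(k < n) clsV W' (x k).
Proof.
have := clsV_sum W' n (fun=> 1) x.
under [in RHS]eq_bigr => k _ do rewrite scale1r.
move=> <-; congr clsV; apply: funext => i; apply: eq_bigr => k _; by rewrite scale1r.
Qed.

End UltraPolynomials.

(** * Solving a system in an existentially closed model *)

Section ExistentiallyClosed.
Variables (L : Lang) (K : fieldType) (D : VSdef L K) (T : formula L -> Prop).
Hypotheses (Hmc : model_complete T) (HV : defines_vs D T).
Variables (M : Struc L) (th : M -> M).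
Hypotheses (HM : Ttheta_model D T th) (ec : ec_model D T th).

Lemma ec_solves (m n : nat) (xi : nat -> {poly K}) (P : nat -> nat -> {poly K})
    (phi : formula L) (p : nat -> M) (v : nat -> M) :
  (forall k, (k < n)%N -> (0 < (size (xi k)).-1)%N) ->
  no_lin_dep D (m + n) phi p ->
  (forall k i, (k < n)%N -> ((size (xi k)).-1 <= i)%N -> ~ ofree (pv (m + k)%N i) phi) ->
  (forall k, (k < n)%N -> inV D (v k)) ->
  exists X : nat -> M,
    [/\ (forall k, (k < m + n)%N -> inV D (X k)),
        holds (ph (fun k i => iter i th (X k)) (m + n) p) phi &
        (forall k, (k < n)%N ->
           polyact D th (xi k) (X (m + k)%N) =
           vadd D (vsum D m (fun l => polyact D th (P k l) (X l))) (v k))].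
Proof.
move=> xi_deg nld phi_free Vv.
have MT : fo_model T M by case: HM.
have W := defines_vs_is_vs HV MT.
have Hth := Ttheta_vlinear HM.
have [I [U [x' [UU x'phi x'free]]]] := generic_tuple W nld.
pose N := upower U M; have NT : fo_model T N by apply: upower_model.
have WN := defines_vs_is_vs HV NT.
pose e : M -> N := @uconst I U L M.
have e_elem : elementary e by apply: uconst_elem.
have He := elementary_vlinear W WN e_elem.
pose E : {linear vsp W -> vsp WN} := vlift W WN He.
have E_inj : injective E.
  move=> u w /(congr1 sval) /= /(emb_inj (@uconst_embedding I U _ L M)); exact: vsp_inj.
have E_cls u : E u = clsV WN (fun=> u) by apply: vlift_uconst.
pose x k i : vsp WN := clsV WN (fun l => x' l k i).
have x_free (c : nat -> {poly K}) u : \sum_(k < m + n) pl (x k) (c k) = E u ->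
    forall k, (k < m + n)%N -> c k = 0.
  move=> eq_u k lt_k; apply/eqP/contraT => ck.
  have Uneq := x'free c u (ex_intro2 _ _ k lt_k ck).
  move: eq_u; rewrite E_cls -(clsV_sumpl WN (m + n) (fun k i l => x' l k i)).
  by move=> /clsV_eq/(filterI Uneq)/filter_ex[l []].
have phi_x : holds (ph (fun k i => sval (x k i)) (m + n) (e \o p)) phi.
  have -> : ph (fun k i => sval (x k i)) (m + n) (e \o p) =
      (fun w => cls U (fun l => ph (fun k j => sval (x' l k j)) (m + n) p w)).
    by apply: funext => w; rewrite /ph; case: ifP => // _; rewrite val_clsV.
  by apply/(Los (fun w l => ph (fun k j => sval (x' l k j)) (m + n) p w)); apply: filterE.
clearbody x.
have [f [fE fx fxi]] := companion_extension (vlift W W Hth) P (fun k => toV W (v k)) E_inj x_free xi_deg.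
pose thN (y : N) : N := if pselect (inV D y) is left Vy then sval (f (exist _ y Vy)) else vzero D N.
have thN_val (y : vsp WN) : thN (sval y) = sval (f y).
  rewrite /thN; case: pselect => [Vy|[]]; last exact: svalP.
  by congr (sval (f _)); apply: vsp_inj.
have thNV (y : N) : ~ inV D y -> thN y = vzero D N by rewrite /thN; case: pselect.
have lift (y : N) : inV D y -> exists y' : vsp WN, y = sval y' by move=> Vy; exists (exist _ y Vy).
have HN : Ttheta_model D T thN.
  split=> //.
  - by move=> _ /lift[y ->]; rewrite thN_val; apply: svalP.
  - move=> _ _ /lift[y ->] /lift[z ->].
    by rewrite -[vadd _ _ _]/(sval (y + z)) !thN_val linearD.
  - move=> c _ /lift[y ->].
    by rewrite -[vsmul _ _ _]/(sval (c *: y)) !thN_val linearZ.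
have e_th z : e (th z) = thN (e z).
  have [Vz|nVz] := pselect (inV D z).
    by rewrite -(val_toV W Vz) -[e (sval _)]/(sval (E (toV W z))) thN_val fE.
  rewrite thNV ?(elementary_inV D e_elem) //; case: HM => _ _ _ _ ->//.
  exact: (elementary_vzero W WN e_elem).
have e_emb : embedding e by apply: uconst_embedding.
(* Existential closedness is applied to diagrams in [Ltheta L]: for each finite list of facts, those
   about theta included, some map to [M] respects them and fixes [M]. *)
have [hh hhP] := choice (exists_partial_embedding (M := expand th) (N := expand thN)
  (emb_inj e_emb) (ec HN e_emb e_th)).
have [U2 [UU2 U2fact]] := finite_subsets_ultrafilter (fact (expand thN)).
have hh_e l z : hh l (e z) = z by have [] := hhP l.
have hh_sat l psi : psi \in l -> sat (hh l) psi by have [+ _] := hhP l; apply.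
have [g_inj g_fun g_rel] := ultra_map_embedding hh_sat U2fact.
pose M2 := upower U2 M; have M2T : fo_model T M2 by apply: upower_model.
have W2 := defines_vs_is_vs HV M2T.
(* The glued map is read in [L] alone, where model completeness makes it elementary; [g_th] keeps
   its compatibility with theta. *)
pose g (y : N) : M2 := cls U2 (fun l => hh l y).
have g_emb : embedding g.
  by split; [exact: g_inj | move=> s; exact: (g_fun (Some s)) | exact: g_rel].
have g_elem : elementary g by move=> psi a; apply: Hmc.
pose G : {linear vsp WN -> vsp W2} := vlift WN W2 (elementary_vlinear WN W2 g_elem).
have g_th y : U2 [set l | hh l (thN y) = th (hh l y)]%classic.
  have := U2fact (@FFun (Ltheta L) (expand thN) None (fun=> y)).
  by apply: filterS => l /hh_sat.
pose Y k l := toV W (hh l (sval (x k 0%N))).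
have YV k : U2 [set l | inV D (hh l (sval (x k 0%N)))]%classic.
  by apply/cls_inV; apply: (vlin_V (elementary_vlinear WN W2 g_elem)); apply: svalP.
have iterY k i : G (iter i f (x k 0%N)) = clsV W2 (fun l => iter i (vlift W W Hth) (Y k l)).
  apply: vsp_inj; rewrite val_clsV /=; apply/cls_eq.
  elim: i => [|i IH] /=.
    by apply: filterS (YV k) => l Vl /=; rewrite /Y val_toV.
  by rewrite -thN_val; apply: filterS (filterI IH (g_th (sval (iter i f (x k 0%N))))) => l [/= <- <-].
have pactY k q : G (pact f q (x k 0%N)) = clsV W2 (fun l => pact (vlift W W Hth) q (Y k l)).
  by rewrite clsV_pact /pact pl_map; apply: pl_ext => i _; rewrite /= iterY.
have eqY : U2 [set l | forall k : 'I_n, pact (vlift W W Hth) (xi k) (Y (m + k)%N l) =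
    \sum_(j < m) pact (vlift W W Hth) (P k j) (Y j l) + toV W (v k)]%classic.
  apply/ultra_forall => k; apply/(clsV_eq W2).
  rewrite -pactY fxi // linearD linear_sum clsVD
    (clsV_sum1 W2 m (fun j l => pact (vlift W W Hth) (P k j) (Y j l))); congr (_ + _).
    by apply: eq_bigr => j _; rewrite pactY.
  apply: vsp_inj; rewrite val_clsV /=; apply/cls_eq; apply: filterE => l /=.
  by rewrite -[RHS](hh_e l).
have phiY : U2 [set l | holds (ph (fun k i => iter i th (hh l (sval (x k 0%N)))) (m + n) p) phi]%classic.
  pose a w l := ph (fun k i => iter i th (hh l (sval (x k 0%N)))) (m + n) p w.
  apply/(Los a).
  have -> : (fun w => cls U2 (a w)) = g \o ph (fun k i => sval (iter i f (x k 0%N))) (m + n) (e \o p).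
    apply: funext => w; rewrite ph_comp /a /ph; case: ifP => _; last first.
      by rewrite /=; apply/cls_eq; apply: filterE => l; rewrite /= hh_e.
    apply/esym; rewrite -[LHS]/(sval (G _)) iterY val_clsV; apply/cls_eq.
    by apply: filterS (YV (pkidx w)) => l Vl /=; rewrite val_iter /Y val_toV.
  (* [phi] mentions a torsion block only below the degree, where [x k i] is the [i]-th iterate of
     [x k 0]; so [phi_x] is a statement about iterates. *)
  have coin w : ofree w phi -> ph (fun k i => sval (iter i f (x k 0%N))) (m + n) (e \o p) w =
      ph (fun k i => sval (x k i)) (m + n) (e \o p) w; last first.
    by rewrite -g_elem; apply/(holds_coincide coin).
  move=> w_free.
  rewrite /ph; case: ifP => // /andP[w0 lt_w]; rewrite fx //.
  case: ltnP => //= le_m; rewrite ltnNge; apply/negP => le_d.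
  have lt_n : (pkidx w - m < n)%N by rewrite ltn_subLR.
  by apply: (phi_free _ _ lt_n le_d); rewrite subnKC // pv_idx.
have VY : U2 [set l | forall k : 'I_(m + n), inV D (hh l (sval (x k 0%N)))]%classic.
  by apply/ultra_forall => k; apply: YV.
(* Formula, equations and membership in V each hold at almost every index, hence at a common one. *)
have [l [[phil eql] Vl]] := filter_ex (filterI (filterI phiY eqY) VY).
have Vl' k : (k < m + n)%N -> inV D (hh l (sval (x k 0%N))) by move=> lt_k; apply: (Vl (Ordinal lt_k)).
exists (fun k => hh l (sval (x k 0%N))); split=> // k lt_k.
have := eql (Ordinal lt_k).
move/(iffRL (val_polyeq Hth m (xi k) (P k) (fun j => Y j l) (Y (m + k)%N l) (toV W (v k)))).
have lt_mk : (m + k < m + n)%N by rewrite ltn_add2l.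
rewrite (val_toV W (Vl' _ lt_mk)) (val_toV W (Vv _ lt_k)) => ->.
congr vadd; apply: vsum_ext => j lt_j; rewrite /Y val_toV //.
by apply: Vl'; rewrite ltn_addr.
Qed.

End ExistentiallyClosed.

(** * Models solving the systems are existentially closed *)

Section CyclicTuples.
Variables (L : Lang) (K : fieldType) (D : VSdef L K) (M N : Struc L).
Variables (WM : is_vs D M) (WN : is_vs D N) (e : M -> N).
Hypotheses (e_inj : injective e) (e_elem : elementary e).
Variable f : {linear vsp WN -> vsp WN}.
Variables (m n : nat) (h : nat -> vsp WN) (xi : nat -> {poly K}).

Let E : {linear vsp WM -> vsp WN} := vlift WM WN (elementary_vlinear WM WN e_elem).
Let B y := exists u, y = E u.

Hypothesis xi_gt1 : forall k, (k < n)%N -> (1 < size (xi k))%N.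
Hypothesis h_free : forall c : nat -> {poly K}, B (\sum_(k < m + n) pact f (c k) (h k)) ->
  (forall k, (k < m)%N -> c k = 0) /\ forall k, (k < n)%N -> xi k %| c (m + k)%N.

(** The indices whose iterates are [K]-linearly independent modulo [B]: all of them in a free block,
    those below the degree of the annihilator in a torsion block. *)
Definition valid k i := (k < m)%N || (k < m + n)%N && (i < (size (xi (k - m)%N)).-1)%N.

Lemma valid_lt k i : valid k i -> (k < m + n)%N.
Proof. by case/orP => [|/andP[]//]; apply: ltn_addr. Qed.

(** In a torsion block validity bounds the degree of [c k] below that of the annihilator dividing
    it. *)
Lemma valid_free (c : nat -> {poly K}) :
  (forall k i, (k < m + n)%N -> (c k)`_i != 0 -> valid k i) ->
  B (\sum_(k < m + n) pact f (c k) (h k)) -> forall k, (k < m + n)%N -> c k = 0.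
Proof.
move=> c_valid /h_free[cm cn] k lt_k; have [lt_m|le_m] := ltnP k m; first exact: cm.
have lt_n : (k - m < n)%N by rewrite ltn_subLR.
have := cn _ lt_n; rewrite subnKC // => xi_c; apply/eqP/contraT => ck.
have := dvdp_leq ck xi_c; rewrite leqNgt => /negP[].
have : (size (c k) <= (size (xi (k - m)%N)).-1)%N.
  apply/leq_sizeP => i le_i; apply/eqP/contraT => /(c_valid _ _ lt_k).
  by rewrite /valid lt_k ltnNge le_m /= ltnNge le_i.
move=> /leq_ltn_trans; apply; rewrite ltn_predL lt0n size_poly_eq0.
by apply: contraTneq xi_c => ->; rewrite dvd0p.
Qed.

Let mono k i : nat -> {poly K} := fun j => if j == k then 'X^i else 0.

Let coef_mono k i j l : (mono k i j)`_l = ((j == k) && (l == i))%:R.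
Proof. by rewrite /mono; case: eqP; rewrite ?coefXn ?coef0. Qed.

Lemma iter_single k i : (k < m + n)%N ->
  iter i f (h k) = \sum_(j < m + n) pact f (mono k i j) (h j).
Proof.
move=> lt_k; rewrite (bigD1 (Ordinal lt_k)) //= /mono eqxx pactXn big1 ?addr0 // => j jk.
by rewrite ifN // /pact linear0.
Qed.

Lemma iter_notB k i : valid k i -> ~ B (iter i f (h k)).
Proof.
move=> ki; have lt_k := valid_lt ki; rewrite iter_single // => Bc.
have mono_valid j l : (j < m + n)%N -> (mono k i j)`_l != 0 -> valid j l.
  by move=> _; rewrite coef_mono; case: andP => [[/eqP-> /eqP->]|_] //; rewrite eqxx.
have /polyP/(_ i) := valid_free mono_valid Bc lt_k.
by rewrite coef_mono coef0 !eqxx => /eqP; rewrite oner_eq0.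
Qed.

(** Equal iterates give a relation whose coefficients are differences of monomials, and [valid_free]
    applies. *)
Lemma iter_inj k i k' i' : valid k i -> valid k' i' ->
  iter i f (h k) = iter i' f (h k') -> k = k' /\ i = i'.
Proof.
move=> ki ki' eq_iter; have lt_k := valid_lt ki; have lt_k' := valid_lt ki'.
pose c j := mono k i j - mono k' i' j.
have Bc : B (\sum_(j < m + n) pact f (c j) (h j)).
  exists 0; rewrite linear0 (eq_bigr (fun j : 'I_(m + n) =>
    pact f (mono k i j) (h j) - pact f (mono k' i' j) (h j))) => [|j _].
    by rewrite sumrB -!iter_single // eq_iter subrr.
  by rewrite /pact linearB.
have c_valid j l : (j < m + n)%N -> (c j)`_l != 0 -> valid j l.
  move=> _; rewrite coefB !coef_mono.
  case: (boolP ((j == k) && (l == i))) => [/andP[/eqP-> /eqP->] //|_].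
  case: (boolP ((j == k') && (l == i'))) => [/andP[/eqP-> /eqP->] //|_].
  by rewrite subrr eqxx.
have /polyP/(_ i) := valid_free c_valid Bc lt_k; rewrite coefB !coef_mono coef0 !eqxx /=.
case: (boolP ((k == k') && (i == i'))) => [/andP[/eqP-> /eqP->] //|_].
by move=> /eqP; rewrite subr0 oner_eq0.
Qed.

(** The reserved variables [q] of the diagram formula: a valid iterate of [h k] is named by its
    placeholder, unambiguously by [iter_inj]. *)
Definition place (y : N) : option nat :=
  if pselect (exists ki : nat * nat, valid ki.1 ki.2 /\ y = sval (iter ki.2 f (h ki.1))) is left ex
  then let ki := sval (cid ex) in Some (pv ki.1 ki.2) else None.

Lemma place_some y v : place y = Some v ->
  exists k i, [/\ valid k i, y = sval (iter i f (h k)) & v = pv k i].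
Proof.
rewrite /place; case: pselect => // ex; case: (cid ex) => -[k i] /= [ki ->] [<-].
by exists k, i.
Qed.

Lemma place_iter k i : valid k i -> place (sval (iter i f (h k))) = Some (pv k i).
Proof.
rewrite /place => ki; case: pselect => [ex|]; last by case; exists (k, i).
case: (cid ex) => -[k' i'] /= [ki' /vsp_inj E'].
by have [-> ->] := iter_inj ki ki' E'.
Qed.

Lemma place_e u : place (e u) = None.
Proof.
case E' : (place _) => [v|//]; have [k [i [ki eu _]]] := place_some E'.
case: (iter_notB ki); have Vu : inV D u.
  by rewrite -(elementary_inV D e_elem) eu; apply: svalP.
by exists (toV WM u); apply: vsp_inj; rewrite -eu /= val_toV.
Qed.

Lemma place_fr y v j : place y = Some v -> pv (m + n) j <> v.
Proof.
case/place_some => k [i [/valid_lt lt_k _ ->]] /pv_inj[E' _].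
by rewrite -E' ltnn in lt_k.
Qed.

Section NoLinearDependence.
Local Open Scope classical_set_scope.
Variables (I : Type) (U : set_system I).
Context {UU : UltraFilter U}.
Variable g : N -> upower U M.
Hypotheses (g_inj : injective g) (g_elem : elementary g) (g_e : forall u, g (e u) = uconst U u).
Variable W1 : is_vs D (upower U M).

Let G : {linear vsp WN -> vsp W1} := vlift WN W1 (elementary_vlinear WN W1 g_elem).

Let G_inj : injective G.
Proof. by move=> x y /(congr1 sval) /g_inj/vsp_inj. Qed.

Let GE u : G (E u) = clsV W1 (fun=> u).
Proof. by apply: vsp_inj; rewrite val_clsV /= g_e. Qed.

(* A finite V(M) would not grow in the ultrapower. *)
Lemma proper_infinite y : ~ B y -> forall s : seq (vsp WN), exists x, x \notin s.
Proof.
move=> nBy s; apply: contrapT => all_s; apply: nBy.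
have in_s x : x \in s by apply: contrapT => /negP xs; apply: all_s; exists x.
have [z yz] := clsV_surj WM (G y).
(* As [s] is finite, the ultrafilter selects one value of [E (z i)], which makes [G y] the class of
   a constant. *)
have [j Uj] : exists j : 'I_(size s), U [set i | E (z i) = nth 0 s j].
  apply: contrapT => nj; have : U [set i | forall j : 'I_(size s), E (z i) <> nth 0 s j].
    by apply/ultra_forall => j; apply/ultraC => Uj; apply: nj; exists j.
  move/filter_ex => [i] /=; have lt_i : (index (E (z i)) s < size s)%N by rewrite index_mem.
  by move/(_ (Ordinal lt_i)); rewrite nth_index.
have [i0 zi0] := filter_ex Uj; exists (z i0); apply: G_inj; rewrite yz GE.
apply/clsV_eq; apply: filterS Uj => i /=; rewrite -zi0 => /(congr1 sval)/e_inj; exact: vsp_inj.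
Qed.

(** The values at invalid indices may be chosen in V(N) so as to violate every equation involving
    one of them; an equation with valid indices only fails by independence. The ultrapower then
    brings this counterexample down to [M]. *)
Lemma tuple_no_lin_dep (psi : formula L) (p : nat -> M) :
  (forall X : nat -> nat -> vsp WN, (forall k i, valid k i -> X k i = iter i f (h k)) ->
     holds (ph (fun k i => sval (X k i)) (m + n) (e \o p)) psi) ->
  no_lin_dep D (m + n) psi p.
Proof.
move=> psiX [J [C [a [v [nontriv cover]]]]].
(* The invalid indices that the equations can involve, that is, the unknowns. *)
pose r := [seq t <- [seq (k, i) | k <- iota 0 (m + n), i <- iota 0 C] | ~~ valid t.1 t.2].
have r_uniq : uniq r.
  by apply: filter_uniq; apply: allpairs_uniq; rewrite ?iota_uniq // => -[? ?] [? ?] _ _ [-> ->].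
pose vN j := E (toV WM (v j)).
(* The contribution of the valid indices is fixed and moved to the right-hand side. *)
pose rhs j := vN j - \sum_(k < m + n) \sum_(i < C) (if valid k i then a j k i *: iter i f (h k) else 0).
have [y yP] : exists y : nat * nat -> vsp WN, forall j, (j < J)%N ->
    (exists2 t, t \in r & a j t.1 t.2 != 0) -> \sum_(t <- r) a j t.1 t.2 *: y t <> rhs j.
  (* With no blocks there are no unknowns; otherwise [h 0] lies outside [B], which makes V(N)
     infinite. *)
  have [mn0|mn_gt0] := posnP (m + n)%N.
    by exists (fun=> 0) => j _ [t]; rewrite /r mn0.
  have valid0 : valid 0 0.
    rewrite /valid mn_gt0; case: ltnP => //= m0; rewrite ltn_predRL xi_gt1 //.
    by move: m0 mn_gt0; rewrite leqn0 => /eqP->; rewrite subn0.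
  pose Eqs := [seq ((fun t : nat * nat => a j t.1 t.2), rhs j) | j <- iota 0 J].
  have [y yP] := avoid_equations (proper_infinite (iter_notB valid0)) Eqs r_uniq.
  exists y => j lt_j; apply: (yP (_, rhs j)); apply: (map_f (fun j => (_, rhs j))).
  by rewrite mem_iota.
pose X k i := if valid k i then iter i f (h k) else y (k, i).
have X_neq j : (j < J)%N -> \sum_(k < m + n) \sum_(i < C) a j k i *: X k i <> vN j.
  move=> lt_j eq_vN.
  (* The choice of [y] defeats an equation with a nonzero invalid coefficient; any other is a
     relation between valid iterates. *)
  have [inv_nz|inv_z] := pselect (exists2 t, t \in r & a j t.1 t.2 != 0).
    apply: (yP j lt_j inv_nz); rewrite /rhs -eq_vN -sumrB /r big_filter big_mkcond.
    rewrite big_allpairs_dep /= -[in LHS](subn0 (m + n)%N) -/(index_iota 0 (m + n)) big_mkord.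
    apply: eq_bigr => k _; rewrite -sumrB -[in LHS](subn0 C) -/(index_iota 0 C) big_mkord.
    by apply: eq_bigr => i _; rewrite /X; case: valid; rewrite ?subrr ?subr0.
  have [_ [k [i [lt_k lt_i aki]]]] := nontriv j lt_j.
  pose c k := \poly_(i < C) a j k i.
  have a_valid k' i' : (k' < m + n)%N -> (i' < C)%N -> a j k' i' != 0 -> valid k' i'.
    move=> lt_k' lt_i' a_nz; apply: contrapT => /negP nv; apply: inv_z; exists (k', i') => //.
    rewrite mem_filter nv; apply/allpairsP; exists (k', i'); split; rewrite // mem_iota //.
  have c_valid k' i' : (k' < m + n)%N -> (c k')`_i' != 0 -> valid k' i'.
    by move=> lt_k'; rewrite coef_poly; case: ltnP; rewrite ?eqxx // => lt_i'; apply: a_valid.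
  have Bc : B (\sum_(k < m + n) pact f (c k) (h k)).
    exists (toV WM (v j)); rewrite -/(vN j) -eq_vN; apply: eq_bigr => k' _.
    rewrite /pact (@pl_bound _ _ _ _ C) ?size_poly //; apply: eq_bigr => i' _.
    rewrite coef_poly ltn_ord /X; case: ifPn => // nv.
    have [->|nz] := eqVneq (a j k' i') 0; first by rewrite !scale0r.
    by case/negP: nv; apply: a_valid.
  have /polyP/(_ i) := valid_free c_valid Bc lt_k.
  by rewrite coef_poly lt_i coef0 => /eqP; rewrite (negPf aki).
have psi_X : holds (ph (fun k i => sval (X k i)) (m + n) (e \o p)) psi.
  by apply: psiX => k i ki; rewrite /X ki.
have [Z ZP] := choice (fun ki : nat * nat => clsV_surj WM (G (X ki.1 ki.2))).
have UZ : U [set l | holds (ph (fun k i => sval (Z (k, i) l)) (m + n) p) psi].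
  apply/(Los (fun w l => ph (fun k i => sval (Z (k, i) l)) (m + n) p w)).
  move: psi_X; rewrite g_elem; congr holds; apply: funext => w; rewrite ph_comp /ph; case: ifP => _; last exact: g_e.
  by rewrite -[LHS]/(sval (G _)) (ZP (_, _)) val_clsV.
have UZn : U [set l | forall j : 'I_J,
    \sum_(k < m + n) \sum_(i < C) a j k i *: Z ((k : nat), (i : nat)) l <> toV WM (v j)].
  apply/ultra_forall => j; apply/ultraC => /(clsV_eq W1).
  rewrite -GE (clsV_sum1 W1 (m + n) (fun k l => \sum_(i < C) a j k i *: Z (k, (i : nat)) l)) => eqG.
  apply: (X_neq j (ltn_ord j)); apply: G_inj; rewrite -eqG linear_sum; apply: eq_bigr => k _.
  rewrite (clsV_sum W1 C (a j k) (fun i => Z (k : nat, i))) linear_sum.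
  by apply: eq_bigr => i _; rewrite linearZ (ZP (_, _)).
have [l [psil neql]] := filter_ex (filterI UZ UZn).
have [|j [lt_j eqj]] := cover (fun k i => sval (Z (k, i) l)) _ psil; first by move=> k i _; apply: svalP.
apply: (neql (Ordinal lt_j)); apply: vsp_inj; rewrite -(val_dep _ _ (a j) (fun k i => Z (k, i) l)) eqj val_toV //.
by have [] := nontriv j lt_j.
Qed.

End NoLinearDependence.

End CyclicTuples.

(** * Descending an existential formula by solving systems *)

Section SolvableIsExistentiallyClosed.
Variables (L : Lang) (K : fieldType) (D : VSdef L K) (T : formula L -> Prop).
Hypotheses (Hmc : model_complete T) (HV : defines_vs D T).
Variables (M : Struc L) (th : M -> M).
Hypothesis HM : Ttheta_model D T th.
Hypothesis solvable : forall (m n : nat) (xi : nat -> {poly K}) (P : nat -> nat -> {poly K})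
    (phi : formula L) (p : nat -> M) (v : nat -> M),
  (forall k, (k < n)%N -> (0 < (size (xi k)).-1)%N) ->
  no_lin_dep D (m + n) phi p ->
  (forall k i, (k < n)%N -> ((size (xi k)).-1 <= i)%N -> ~ ofree (pv (m + k)%N i) phi) ->
  (forall k, (k < n)%N -> inV D (v k)) ->
  exists X : nat -> M,
    [/\ (forall k, (k < m + n)%N -> inV D (X k)),
        holds (ph (fun k i => iter i th (X k)) (m + n) p) phi &
        (forall k, (k < n)%N ->
           polyact D th (xi k) (X (m + k)%N) =
           vadd D (vsum D m (fun l => polyact D th (P k l) (X l))) (v k))].

Lemma solvable_ec : ec_model D T th.
Proof.
move=> N thN e HN e_emb e_th phi a phi_ex phi_N.
have e_inj := emb_inj e_emb.
have MT : fo_model T M by case: HM.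
have NT : fo_model T N by case: HN.
have WM := defines_vs_is_vs HV MT; have WN := defines_vs_is_vs HV NT.
have Hth := Ttheta_vlinear HM; have HthN := Ttheta_vlinear HN.
have e_elem : elementary e by move=> psi c; apply: Hmc.
pose fM : {linear vsp WM -> vsp WM} := vlift WM WM Hth.
pose fN : {linear vsp WN -> vsp WN} := vlift WN WN HthN.
pose E : {linear vsp WM -> vsp WN} := vlift WM WN (elementary_vlinear WM WN e_elem).
have E_iter i u : E (iter i fM u) = iter i fN (E u).
  by elim: i => //= i <-; apply: vsp_inj; rewrite /= e_th.
have E_pact q u : E (pact fM q u) = pact fN q (E u).
  by rewrite /pact pl_map; apply: pl_ext => i _; rewrite /= E_iter.
have [vs [chi [qf_chi phiE]]] := existential_exs phi_ex.
move: phi_N; rewrite phiE => /holds_exs[b [b_a chi_b]].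
have [l0 l0P] := qf_facts b qf_chi.
pose s0 : seq N := factelems l0.
(* V(M) inside V(N), a [{poly K}]-submodule because [e] commutes with theta. *)
pose B (y : pmod fN) := exists u, y = E u.
have B0 : B 0 by exists 0; rewrite linear0.
have Bcl (c : {poly K}) (x y : pmod fN) : B x -> B y -> B (c *: x + y).
  move=> [u ->] [w ->]; exists (pact fM c u + w).
  by rewrite pmod_scaleE linearD E_pact.
(* The generators are the elements occurring in the facts [l0] that decide [chi]; those outside V
   enter as 0. *)
have [m [n [h [xi [xi_gt1 xi_h h_free s0_h _]]]]] :=
  cyclic_decomposition B0 Bcl (fun i : 'I_(size s0) => toV WN (nth (vzero D N) s0 i)).
have {}h_free : forall c : nat -> {poly K},
    (exists u, \sum_(k < m + n) pact fN (c k) (h k) = vlift WM WN (elementary_vlinear WM WN e_elem) u) ->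
    (forall k, (k < m)%N -> c k = 0) /\ forall k, (k < n)%N -> xi k %| c (m + k)%N := h_free.
(* These maps ignore theta. They only embed [N] over [M] into an ultrapower, as [tuple_no_lin_dep]
   requires. *)
have [h1 h1P] := choice (exists_partial_embedding e_inj (fun psi c _ => (e_elem psi c).2)).
have [U [UU Ufact]] := finite_subsets_ultrafilter (fact N).
pose M1 := upower U M; have M1T : fo_model T M1 by apply: upower_model.
have W1 := defines_vs_is_vs HV M1T.
have ultra_elem (hh : seq (fact N) -> N -> M) : (forall l psi, psi \in l -> sat (hh l) psi) ->
    embedding (ultra_map hh U : N -> M1) /\ elementary (ultra_map hh U : N -> M1).
  move=> hh_sat; have emb : embedding (ultra_map hh U : N -> M1) by apply: ultra_map_embedding.
  by split=> // psi c; apply: Hmc.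
have xi_w k : exists w, (k < n)%N -> pact fN (xi k) (h (m + k)%N) = E w.
  by case: ltnP => [/xi_h[u xih]|_]; [exists u | exists 0].
have [w wP] := choice xi_w.
pose fr := pv (m + n).
have fr_inj : injective fr by move=> i j /pv_inj[].
pose q := place fN m n h xi.
(* For each finite list of facts: a solution of the torsion equations in V(M), and a map realizing
   the list that sends the listed valid iterates of [h] to the iterates of that solution. *)
have sol l : exists XH : (nat -> vsp WM) * (N -> M),
    [/\ forall psi, psi \in l -> sat XH.2 psi,
        forall k i, valid m n xi k i -> sval (iter i fN (h k)) \in factelems l ->
          XH.2 (sval (iter i fN (h k))) = sval (iter i fM (XH.1 k)),
        forall u, XH.2 (e u) = u &
        forall k, (k < n)%N -> pact fM (xi k) (XH.1 (m + k)%N) = w k].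
  have [p pP] := parameters_exist l e_inj fr_inj.
  pose psi := diagram_formula e l q fr.
  have nld : no_lin_dep D (m + n) psi p.
    have h1_sat l' x : x \in l' -> sat (h1 l') x by have [+ _] := h1P l'; apply.
    have [emb elem] := ultra_elem h1 h1_sat.
    apply: (tuple_no_lin_dep e_inj xi_gt1 h_free (emb_inj emb) elem _ W1).
      by move=> u; apply: ultra_map_const => l' u'; have [_] := h1P l'.
    move=> X XE; apply: diagram_holds => //.
    - by move=> y v' j; apply: place_fr.
    - move=> y v' _ /place_some[k [i [ki -> ->]]].
      by rewrite ph_pv ?(valid_lt ki) // XE.
    - by move=> u us; rewrite ph_param /= pP.
  have [||k lt_k|X [XV psiX Xeq]] := @solvable m n xi (fun _ _ => 0) psi p (fun k => sval (w k)) _ nld.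
  - by move=> k /xi_gt1; case: (size _) => [|[]].
  (* A free variable of [psi] is either a valid placeholder, hence below the degree, or lies in
     block [m + n]. *)
  - move=> k i lt_k le_i /ofree_diagram[[y _ /place_some[k' [i' [ki' _]]]]|[j]] /pv_inj[Ek Ei].
      move: ki'; rewrite /valid -Ek -Ei addKn ltnNge leq_addr /= => /andP[_].
      by rewrite ltnNge le_i.
    by move: lt_k; rewrite -(ltn_add2l m) Ek ltnn.
  - exact: svalP.
  have [|||hh [hh_sat hh_q hh_e]] := diagram_realize e_inj fr_inj _ _ psiX.
  - exact: (place_e h_free).
  - by move=> y v' j; apply: place_fr.
  - by move=> u us; rewrite ph_param pP.
  exists (fun k => toV WM (X k), hh); split=> //= [k i ki ys|k lt_k].
    rewrite (hh_q _ _ ys (place_iter h_free ki)) ph_pv ?(valid_lt ki) //.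
    by rewrite val_iter val_toV //; apply: XV; apply: valid_lt ki.
  have VX : inV D (X (m + k)%N) by apply: XV; rewrite ltn_add2l.
  apply: vsp_inj; rewrite -(val_pact Hth) (val_toV WM VX) Xeq //.
  have -> : vsum D m (fun j => polyact D th 0 (X j)) = sval (\sum_(j < m) 0 : vsp WM).
    by rewrite -(val_vsum m (fun=> 0)); apply: vsum_ext => j _; rewrite /polyact size_poly0.
  by rewrite big1 // vs_add0 //; apply: svalP.
have [XH XHP] := choice sol.
pose hh l := (XH l).2; pose Y k l := (XH l).1 k.
have hh_sat l psi : psi \in l -> sat (hh l) psi by have [+ _ _ _] := XHP l; apply.
have [g_emb g_elem] := ultra_elem hh hh_sat.
pose g : N -> M1 := ultra_map hh U.
have hh_e l u : hh l (e u) = u by have [_ _ + _] := XHP l; apply.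
pose G : {linear vsp WN -> vsp W1} := vlift WN W1 (elementary_vlinear WN W1 g_elem).
have GE u : G (E u) = clsV W1 (fun=> u).
  by apply: vsp_inj; rewrite val_clsV /=; apply/cls_eq; apply: filterE => l; apply: hh_e.
have G_valid k i : valid m n xi k i -> G (iter i fN (h k)) = clsV W1 (fun l => iter i fM (Y k l)).
  move=> ki; apply: vsp_inj; rewrite val_clsV; apply/cls_eq.
  (* The void fact comparing the iterate with itself serves to put it among the elements of the
     list. *)
  apply: filterS (Ufact (FNeq (sval (iter i fN (h k))) (sval (iter i fN (h k))))) => l ll.
  have [_ + _ _] := XHP l; apply=> //; apply/flattenP.
  by exists (elems (FNeq (sval (iter i fN (h k))) (sval (iter i fN (h k))))); rewrite ?map_f ?mem_head.
have G_pact k c : (k < m + n)%N -> G (pact fN c (h k)) = clsV W1 (fun l => pact fM c (Y k l)).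
  have small (c' : {poly K}) : (forall i, (i < size c')%N -> valid m n xi k i) ->
      G (pact fN c' (h k)) = clsV W1 (fun l => pact fM c' (Y k l)).
    by move=> c'_valid; rewrite clsV_pact /pact pl_map; apply: pl_ext => i /c'_valid; apply: G_valid.
  have [lt_m|le_m] := ltnP k m; first by move=> _; apply: small => i _; rewrite /valid lt_m.
  move=> lt_k; have lt_n : (k - m < n)%N by rewrite ltn_subLR.
  have h_k : pact fN (xi (k - m)%N) (h k) = E (w (k - m)%N) by rewrite -wP // subnKC.
  have Y_k l : pact fM (xi (k - m)%N) (Y k l) = w (k - m)%N.
    by have [_ _ _ <- //] := XHP l; rewrite subnKC.
  have xi0 : xi (k - m)%N != 0 by rewrite -size_poly_gt0 ltnW // xi_gt1.
  (* Modulo the annihilator only valid iterates remain; the quotient acts on [w (k - m)], the same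
     element of V(M) on both sides. *)
  rewrite (divp_eq c (xi (k - m)%N)) pactD pactM h_k -E_pact linearD GE small; last first.
    move=> i lt_i; rewrite /valid lt_k; apply/orP; right.
    by rewrite ltn_predRL (leq_ltn_trans lt_i) // ltn_modp.
  rewrite -clsVD; congr clsV; apply: funext => l; by rewrite pactD pactM Y_k.
have G_span u (c : nat -> {poly K}) y : y = E u + \sum_(k < m + n) pact fN (c k) (h k) ->
    G y = clsV W1 (fun l => u + \sum_(k < m + n) pact fM (c k) (Y k l)).
  move=> ->; rewrite clsVD (clsV_sum1 W1 (m + n) (fun k l => pact fM (c k) (Y k l))) linearD GE.
  by rewrite linear_sum; congr (_ + _); apply: eq_bigr => k _; apply: G_pact.
(* Inside V both [y] and its image under theta are combinations of the [h k], the second with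
   coefficients multiplied by ['X], and [G_span] computes both. Outside V both sides are zero. *)
have hh_th y : y \in s0 -> U [set l | hh l (thN y) = th (hh l y)]%classic.
  move=> ys0; have [Vy|nVy] := pselect (inV D y).
    have lt_y : (index y s0 < size s0)%N by rewrite index_mem.
    have [c [u /eqP]] := s0_h (Ordinal lt_y); rewrite nth_index // subr_eq addrC => /eqP y_span.
    pose c' k := oapp c 0 (insub k).
    have {}y_span : toV WN y = E u + \sum_(k < m + n) pact fN (c' k) (h k).
      by rewrite y_span addrC; congr (_ + _); apply: eq_bigr => k _; rewrite /c' valK.
    pose z l := u + \sum_(k < m + n) pact fM (c' k) (Y k l).
    have mulX (V : lmodType K) (f : {linear V -> V}) (x : V) (hs : nat -> V) :
        f (x + \sum_(k < m + n) pact f (c' k) (hs k)) =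
        f x + \sum_(k < m + n) pact f (c' k * 'X) (hs k).
      by rewrite linearD linear_sum; congr (_ + _); apply: eq_bigr => k _; rewrite pact_mulX pact_comm.
    have thy_span : fN (toV WN y) = E (fM u) + \sum_(k < m + n) pact fN (c' k * 'X) (h k).
      by rewrite y_span mulX (E_iter 1%N u).
    have /(congr1 sval) := G_span u c' _ y_span; rewrite val_clsV /= val_toV // => /cls_eq hh_y.
    have /(congr1 sval) := G_span (fM u) (fun k => c' k * 'X) _ thy_span; rewrite val_clsV /= val_toV // => /cls_eq hh_thy.
    by apply: filterS (filterI hh_y hh_thy) => l [/= -> ->]; rewrite -[RHS]/(sval (fM (z l))) mulX.
  have thy : thN y = e (vzero D M).
    by rewrite (elementary_vzero WM WN e_elem); case: HN => _ _ _ _ ->.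
  have nVgy : U [set l | ~ inV D (hh l y)]%classic.
    apply/ultraC; move/(cls_inV D); rewrite -[cls _ _]/(g y) => Vgy; apply: nVy.
    by apply/(elementary_inV D g_elem).
  apply: filterS nVgy => l nV; rewrite /= thy hh_e.
  by case: HM => _ _ _ _ ->.
(* Facts of [L] belong to almost every list; a fact about theta holds by [hh_th], its argument being
   in [s0]. *)
have l0_sat : U [set l | forall psi, psi \in l0 -> sat (hh l : expand thN -> expand th) psi]%classic.
  have sat_often psi : psi \in l0 -> U [set l | sat (hh l : expand thN -> expand th) psi]%classic.
    move=> psil; case: psi psil => [y z|[s|] args|r args] psil.
    - by apply: filterS (Ufact (@FNeq L N y z)) => l /hh_sat.
    - by apply: filterS (Ufact (@FFun L N s args)) => l /hh_sat.
    - apply: hh_th; apply/flattenP; exists (elems (@FFun (Ltheta L) (expand thN) None args)).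
        exact: map_f.
      by rewrite inE codom_f orbT.
    - by apply: filterS (Ufact (@FRel L N r args)) => l /hh_sat.
  elim: (l0) sat_often => [|psi s IH] often; first by apply: filterE.
  have Us : U [set l | forall psi, psi \in s -> sat (hh l : expand thN -> expand th) psi]%classic.
    by apply: IH => x xs; apply: often; rewrite inE xs orbT.
  apply: filterS (filterI Us (often _ (mem_head _ _))) => l [/= ls lpsi] x.
  by rewrite inE => /predU1P[->|/ls].
have [l lP] := filter_ex l0_sat.
apply/holds_exs; exists (hh l \o b); split; last by apply: (l0P (expand th) (hh l) lP).2.
by move=> x /b_a /= ->; apply: hh_e.
Qed.

End SolvableIsExistentiallyClosed.

Theorem theorem3p40 (L : Lang) (K : fieldType) (D : VSdef L K)
  (T : formula L -> Prop)
  (HT : is_theory T) (Hmc : model_complete T) (HV : defines_vs D T)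
  (M : Struc L) (th : M -> M) (HM : Ttheta_model D T th) :
  ec_model D T th <->
  (forall (m n : nat) (xi : nat -> {poly K}) (P : nat -> nat -> {poly K})
          (phi : formula L) (p : nat -> M) (v : nat -> M),
     (forall k, (k < n)%N -> (0 < (size (xi k)).-1)%N) ->
     no_lin_dep D (m + n) phi p ->
     (forall k i, (k < n)%N -> ((size (xi k)).-1 <= i)%N -> ~ ofree (pv (m + k)%N i) phi) ->
     (forall k, (k < n)%N -> inV D (v k)) ->
     exists X : nat -> M,
       [/\ (forall k, (k < m + n)%N -> inV D (X k)),
           holds (ph (fun k i => iter i th (X k)) (m + n) p) phi &
           (forall k, (k < n)%N ->
              polyact D th (xi k) (X (m + k)%N) =
              vadd D (vsum D m (fun l => polyact D th (P k l) (X l))) (v k))]).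
Proof.
by split=> [ec m n xi P phi p v|]; [exact: (ec_solves Hmc HV HM ec) | exact: (solvable_ec Hmc HV HM)].
Qed.
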